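(* Let $s^*\in(0,1)$, $\mu_1,\mu_2\in C([0,1])$ with $d_\infty=\|\mu_1-\mu_2\|>0$, and let $(X_{n,j}\colon n\in\mathbb{N},\ j=1,\dots,n)$ be an array of $C([0,1])$-valued random variables that satisfies conditions (A1)–(A5) of the context, where the random variable $M$ in (A3) is bounded, and whose means satisfy $\mathbb{E}[X_{n,j}]=\mu_1$ for $j\le\lfloor ns^*\rfloor$ and $\mathbb{E}[X_{n,j}]=\mu_2$ for $j>\lfloor ns^*\rfloor$. For $s,t\in[0,1]$ let $$\hat{\mathbb U}_n(s,t)=\frac1n\Big(\sum_{j=1}^{\lfloor sn\rfloor}X_{n,j}(t)+n\Big(s-\frac{\lfloor sn\rfloor}{n}\Big)X_{n,\lfloor sn\rfloor+1}(t)-s\sum_{j=1}^nX_{n,j}(t)\Big)$$ (the second summand being $0$ for $s=1$). Then the estimator $$\tilde s=\frac1n\,\min\Big(\arg\max_{1\le k<n}\big\|\hat{\mathbb U}_n\big(\tfrac kn,\cdot\big)\big\|\Big)$$ satisfies $|\tilde s-s^*|=O_{\mathbb P}(n^{-1})$ as $n\to\infty$.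
   Context: $[0,1]$ (as the domain of the functions $X_{n,j}$) is equipped with a metric $\rho$ such that $([0,1],\rho)$ is totally bounded. $C([0,1])$ carries the sup norm $\|\cdot\|$ and its Borel $\sigma$-field; $\arg\max$ denotes the set of maximizing indices $k$. For $\sigma$-fields $\mathcal F,\mathcal G$ put $\phi(\mathcal F,\mathcal G)=\sup\{|\mathbb{P}(G|F)-\mathbb{P}(G)|\colon F\in\mathcal F,\ G\in\mathcal G,\ \mathbb{P}(F)>0\}$. For a triangular array let $\mathcal F^n_{k,k'}$ be the $\sigma$-field generated by $(X_{n,j}\colon k\le j\le k')$ and $\varphi(k)=\sup_{n>k}\max_{k'=1,\dots,n-k}\phi(\mathcal F^n_{1,k'},\mathcal F^n_{k'+k,n})$. Write $\mu^{(j)}=\mathbb{E}[X_{n,j}]$ (in the change-point model this depends on $n$ through $\lfloor ns^*\rfloor$). Conditions: (A1) there is a constant $K$ such that, for some $\nu>0$, $\mathbb{E}[\|X_{n,j}\|^{2+\nu}]\le K$ for all $n\in\mathbb{N}$, $j=1,\dots,n$; (A2) the centered array $(X_{n,j}-\mu^{(j)})$ is rowwise stationary, and $\mathrm{Cov}(X_{n,j}(t),X_{n,j'}(t'))=\gamma(j-j',t,t')$ for all $n$ and $j,j'=1,\dots,n$; (A3) there is a real random variable $M$ with $\mathbb{E}[M^2]<\infty$ such that, for all $n$ and $j=1,\dots,n$, almost surely $|X_{n,j}(t)-X_{n,j}(t')|\le M\rho(t,t')$ for all $t,t'\in[0,1]$; (A4) there is $a\in[0,1)$ with $\varphi(k)\le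 a^k$ for all $k\in\mathbb{N}$; (A5) for any sequence $(r_n)\subset\mathbb{N}$ with $r_n\le n$ and $r_n/n\to0$, $\frac{1}{\sqrt n}\sum_{j=1}^{r_n}(X_{n,j}-\mu^{(j)})=o_{\mathbb P}(1)$. *)

(* Defs.v *)
From HB Require Import structures.
From mathcomp Require Import all_boot all_order all_algebra.
From mathcomp Require Import all_classical all_reals all_analysis.

Set Implicit Arguments.
Unset Strict Implicit.
Unset Printing Implicit Defensive.

Import Order.TTheory GRing.Theory Num.Theory.
Import numFieldNormedType.Exports.

Local Open Scope classical_set_scope.
Local Open Scope ring_scope.

Definition unit_itv (R : realType) : Type := set_type `[0 : R, 1]%classic.

HB.instance Definition _ (R : realType) := Topological.on (unit_itv R).

(* C([0,1]), for the usual topology of [0,1]. *)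
Record C01 (R : realType) : Type := MkC01 {
  C01_fun :> unit_itv R -> R;
  C01_continuous : continuous C01_fun }.

Section C01_normed.
Context {R : realType}.
Local Notation I := (unit_itv R).
Local Notation C := (C01 R).
Implicit Types f g h : C.

HB.instance Definition _ := gen_eqMixin C.
HB.instance Definition _ := gen_choiceMixin C.

Lemma C01P f g : (forall t, f t = g t) -> f = g.
Proof.
case: f g => [f cf] [g cg] /= /funext fg; subst g.
by congr MkC01; exact: Prop_irrelevance.
Qed.

Let cont_opp f : continuous (fun t => - f t).
Proof. by move=> t; apply: continuousN; exact: C01_continuous. Qed.

Let cont_add f g : continuous (fun t => f t + g t).
Proof. by move=> t; apply: continuousD; exact: C01_continuous. Qed.

Let cont_scale (a : R) f : continuous (fun t => a * f t).
Proof.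
move=> t; apply: (@continuousM R I (cst a) f t).
  exact: cst_continuous.
exact: C01_continuous.
Qed.

Let cont0 : continuous (fun _ : I => 0 : R).
Proof. by move=> t; exact: cst_continuous. Qed.

Definition C01_zero : C := MkC01 cont0.
Definition C01_opp f : C := MkC01 (@cont_opp f).
Definition C01_add f g : C := MkC01 (@cont_add f g).
Definition C01_scale (a : R) f : C := MkC01 (@cont_scale a f).

Let addA : associative C01_add.
Proof. by move=> f g h; apply: C01P => t; exact: addrA. Qed.
Let addC : commutative C01_add.
Proof. by move=> f g; apply: C01P => t; exact: addrC. Qed.
Let add0 : left_id C01_zero C01_add.
Proof. by move=> f; apply: C01P => t; exact: add0r. Qed.
Let addN : left_inverse C01_zero C01_opp C01_add.
Proof. by move=> f; apply: C01P => t; exact: addNr. Qed.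

HB.instance Definition _ := GRing.isZmodule.Build C addA addC add0 addN.

Let scaleA a b f : C01_scale a (C01_scale b f) = C01_scale (a * b) f.
Proof. by apply: C01P => t; exact: mulrA. Qed.
Let scale1 : left_id 1 C01_scale.
Proof. by move=> f; apply: C01P => t; exact: mul1r. Qed.
Let scaleDr : right_distributive C01_scale +%R.
Proof. by move=> a f g; apply: C01P => t; exact: mulrDr. Qed.
Let scaleDl f : {morph C01_scale^~ f : a b / a + b}.
Proof. by move=> a b; apply: C01P => t; exact: mulrDl. Qed.

HB.instance Definition _ :=
  GRing.Zmodule_isLmodule.Build R C scaleA scale1 scaleDr scaleDl.

Lemma C01_0E t : (0 : C) t = 0. Proof. by []. Qed.
Lemma C01_NE f t : (- f) t = - f t. Proof. by []. Qed.
Lemma C01_DE f g t : (f + g) t = f t + g t. Proof. by []. Qed.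
Lemma C01_ZE (a : R) f t : (a *: f) t = a * f t. Proof. by []. Qed.

Definition supnorm f : R := sup (range (fun t => `|f t|)).

Lemma C01_bounded f : has_ubound (range (fun t => `|f t|)).
Proof.
have cf : {within `[0, 1], continuous (valL_ (0 : R) (f : I -> R))}.
  exact/subspace_valL_continuousP'/C01_continuous.
have : bounded_set (valL_ (0 : R) (f : I -> R) @` `[0, 1]).
  by apply/compact_bounded/continuous_compact => //; exact: segment_compact.
case=> B [_ /(_ (B + 1))]; rewrite ltrDl ltr01 => /(_ isT) fB.
exists (B + 1) => _ [t _ <-]; apply: fB.
exists (set_val t); first exact: set_valP.
by rewrite -[in RHS](valLK 0 (f : I -> R)).
Qed.

Let zero01 : I.
Proof. by exists (0 : R); rewrite inE /= in_itv /= lexx ler01. Qed.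

Lemma supnorm_ub f t : `|f t| <= supnorm f.
Proof. by apply: ub_le_sup; [exact: C01_bounded | exists t]. Qed.

Lemma supnorm_le f (b : R) : (forall t, `|f t| <= b) -> supnorm f <= b.
Proof.
move=> fb; apply: ge_sup; first by exists `|f zero01|; exists zero01.
by move=> _ [t _ <-].
Qed.

Let supnormD f g : supnorm (f + g) <= supnorm f + supnorm g.
Proof.
apply: supnorm_le => t; rewrite C01_DE (le_trans (ler_normD _ _))//.
by rewrite lerD ?supnorm_ub.
Qed.

Let supnormZ (a : R) f : supnorm (a *: f) = `|a| * supnorm f.
Proof.
apply/eqP; rewrite eq_le; apply/andP; split.
  by apply: supnorm_le => t; rewrite C01_ZE normrM ler_wpM2l ?supnorm_ub.
have [->|a0] := eqVneq a 0.
  rewrite normr0 mul0r; apply: le_trans (supnorm_ub _ zero01).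
  exact: normr_ge0.
rewrite -ler_pdivlMl ?normr_gt0//; apply: supnorm_le => t.
rewrite ler_pdivlMl ?normr_gt0// -normrM -C01_ZE; exact: supnorm_ub.
Qed.

Let supnorm0_eq0 f : supnorm f = 0 -> f = 0.
Proof.
move=> f0; apply: C01P => t; apply/eqP; rewrite C01_0E -normr_le0 -f0.
exact: supnorm_ub.
Qed.

HB.instance Definition _ :=
  Lmodule_isNormed.Build R C supnormD supnormZ supnorm0_eq0.

Lemma C01_normE f : `|f| = sup (range (fun t => `|f t|)). Proof. by []. Qed.

(* The Borel sigma-field of the norm topology. *)
HB.instance Definition _ := @isMeasurable.Build (sigma_display (@open C)) C
  <<s @open C >> (@sigma_algebra0 _ setT (@open C))
  (@sigma_algebraC _ (@open C)) (@sigma_algebra_bigcup _ setT (@open C)).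

End C01_normed.

Section metric.
Context {R : realType} {T : Type}.

Definition is_metric (rho : T -> T -> R) : Prop :=
  [/\ forall x y, 0 <= rho x y,
      forall x y, rho x y = 0 <-> x = y,
      forall x y, rho x y = rho y x
    & forall x y z, rho x z <= rho x y + rho y z].

Definition totally_bounded (rho : T -> T -> R) : Prop :=
  forall e : R, 0 < e ->
    exists F : set T, finite_set F /\ forall x, exists2 c, F c & rho c x < e.

End metric.

Section probability.
Context {R : realType} {d : measure_display} {Omega : measurableType d}.
Variable P : probability Omega R.

(* Weak (Pettis) expectation of a random element of a normed space. *)
Definition is_expectation (E : normedModType R) (X : Omega -> E) (m : E) : Prop :=
  forall l : {linear E -> R^o}, continuous (l : E -> R^o) ->
    P.-integrable setT (fun w => (l (X w))%:E) /\
    ('E_P[fun w => l (X w)] = (l m)%:E)%E.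

Definition cond_prob (G F : set Omega) : R := fine (P (G `&` F)) / fine (P F).

Definition phi_mix (calF calG : set (set Omega)) : \bar R :=
  ereal_sup [set x | exists F G, [/\ calF F, calG G, (0 < P F)%E
                                   & x = `|cond_prob G F - fine (P G)|%:E]].

Definition littleo_P1 (Y : nat -> Omega -> R) : Prop :=
  forall e : R, 0 < e -> P [set w | e < `|Y n w|] @[n --> \oo] --> 0%E.

Definition bigO_P (Y : nat -> Omega -> R) (a : nat -> R) : Prop :=
  forall e : R, 0 < e -> exists C : R,
    \forall n \near \oo, (P [set w | (C * `|a n| < `|Y n w|)%R] < e%:E)%E.

End probability.

(* Arrays are total functions of (n, j) with 1-based j; only the entries with
   1 <= j <= n are constrained. *)
Section array.
Context {R : realType} {d : measure_display} {Omega : measurableType d}.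
Variable P : probability Omega R.
Variable X : nat -> nat -> Omega -> C01 R.

Definition row_field (n k k' : nat) : set (set Omega) :=
  <<s \bigcup_(j in [set j | (k <= j <= k')%N])
        preimage_set_system setT (X n j) measurable >>.

Definition mix_coef (k : nat) : \bar R :=
  ereal_sup [set x | exists2 n, (k < n)%N &
    x = (\big[maxe/-oo]_(1 <= k' < (n - k).+1)
           phi_mix P (row_field n 1 k') (row_field n (k' + k) n))%E].

Definition centered (mu : nat -> nat -> C01 R) (n j : nat) (w : Omega) : C01 R :=
  X n j w - mu n j.

(* (Z_{n,1}, ..., Z_{n,m}) and (Z_{n,1+h}, ..., Z_{n,m+h}) have the same law
   whenever both blocks lie in row n. *)
Definition rowwise_stationary (Z : nat -> nat -> Omega -> C01 R) : Prop :=
  forall n m h, (m + h <= n)%N ->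
  forall B : set (m.-tuple (C01 R)), measurable B ->
    P [set w | B [tuple Z n (1 + i)%N w | i < m]] =
    P [set w | B [tuple Z n (1 + i + h)%N w | i < m]].

Definition condA1 : Prop := exists K nu : R, 0 < nu /\
  forall n j, (1 <= j <= n)%N ->
    ('E_P[fun w => (`|X n j w| `^ (2 + nu))%R] <= K%:E)%E.

Definition condA2 (mu : nat -> nat -> C01 R) : Prop :=
  rowwise_stationary (centered mu) /\
  exists gamma : int -> unit_itv R -> unit_itv R -> R,
    forall n j j', (1 <= j <= n)%N -> (1 <= j' <= n)%N -> forall t t',
      covariance P (fun w => X n j w t) (fun w => X n j' w t') =
      (gamma (j%:Z - j'%:Z) t t')%:E.

Definition condA3 (rho : unit_itv R -> unit_itv R -> R) (M : Omega -> R) : Prop :=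
  ('E_P[fun w => (M w ^+ 2)%R] < +oo)%E /\
  forall n j, (1 <= j <= n)%N ->
    {ae P, forall w, forall t t', `|X n j w t - X n j w t'| <= M w * rho t t'}.

Definition condA4 : Prop := exists a : R, 0 <= a < 1 /\
  forall k, (1 <= k)%N -> (mix_coef k <= (a ^+ k)%:E)%E.

Definition condA5 (mu : nat -> nat -> C01 R) : Prop :=
  forall r : nat -> nat, (forall n, (r n <= n)%N) ->
    ((r n)%:R / n%:R : R) @[n --> \oo] --> (0 : R) ->
    littleo_P1 P (fun n w =>
      `|(Num.sqrt n%:R)^-1 *: \sum_(1 <= j < (r n).+1) centered mu n j w|).

(* The function t |-> U_n(s, t). For s = 1 the interpolation coefficient is 0,
   so the entry X n n.+1 outside the array does not contribute. *)
Definition Uhat (n : nat) (s : R) (w : Omega) : C01 R :=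
  let m := Num.truncn (s * n%:R) in
  n%:R^-1 *: (\sum_(1 <= j < m.+1) X n j w
              + (n%:R * (s - m%:R / n%:R)) *: X n m.+1 w
              - s *: \sum_(1 <= j < n.+1) X n j w).

Definition argmax_idx (n : nat) (f : nat -> R) : seq nat :=
  [seq k <- index_iota 1 n | all (fun i => f i <= f k) (index_iota 1 n)].

(* The default value n is only reached when n <= 1 (empty range of k). *)
Definition s_tilde (n : nat) (w : Omega) : R :=
  (\big[minn/n]_(k <- argmax_idx n (fun k => `|Uhat n (k%:R / n%:R) w|)) k)%:R
  / n%:R.

End array.

Definition cp_mean (R : realType) (s : R) (mu1 mu2 : C01 R) (n j : nat) : C01 R :=
  if (j <= Num.truncn (n%:R * s))%N then mu1 else mu2.

(* Main.v *)
(** Writing [U_n(k/n) = h(k) (mu1 - mu2) + W(k)] with a tent [h] whose peak is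
    at [K = floor(n s)], the maximizer lies within [C] of [K] as soon as, for
    all [m >= C], the sums of the [m] centered variables on either side of [K]
    are at most [e m] in sup norm.  Since [M] is bounded, the paths are
    almost surely Lipschitz for [rho] with a common constant, so a finite net
    reduces this to finitely many real sequences.  For those, phi-mixing at
    geometric rate and the moments of order [2 + nu] make covariances decay
    geometrically, so [E (S_m ^ 2) = O(m)].  The classical route through the
    squares [m = q ^ 2] then suffices: the energy
    [sum_(q >= q0) (S_(q^2) ^ 2 + T_q ^ 2) / q ^ 4], where [T_q] is the absolute
    sum over the gap from [q ^ 2] to [(q + 1) ^ 2], has mean [O(1 / q0)] uniformly
    in [n], and bounding it bounds every [|S_m| / m] with [m >= q0 ^ 2]. *)

From HB Require Import structures.
Require Import Defs.
From mathcomp Require Import all_boot all_order all_algebra.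
From mathcomp Require Import all_classical all_reals all_analysis.
From mathcomp Require Import measurable_realfun ring lra zify.

Set Implicit Arguments.
Unset Strict Implicit.
Unset Printing Implicit Defensive.

Import Order.TTheory GRing.Theory Num.Theory.
Import numFieldNormedType.Exports.

Local Open Scope classical_set_scope.
Local Open Scope ring_scope.

(** * Expectation and covariance of square-integrable variables *)

(** Why squares: a second moment of order [m] gives only [P(|S_m| > e m) = O(1 / m)], and these
    bounds diverge when summed over all [m >= C]. Along [m = q ^ 2] they sum to [O(1 / q0)]. A gap
    holds [2 q + 1] indices, so even without decorrelation inside it [E (T_q ^ 2) = O(q ^ 2)], the
    same order as [E (S_(q^2) ^ 2)]. One Markov bound on the energy thus takes the place of a
    maximal inequality. Why the rate is [1 / n]: the drop of the tent from [K] to [k] and the change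
    of the noise are both linear in [|k - K| / n], with slope at least [c] for the former and at
    most [2 e] for the latter. A fixed small [e] separates them at every distance beyond [C], and
    [C] depends on neither [n] nor [K]. Why staircases: mixing speaks of events, covariances of
    unbounded variables. A staircase function of [X] is a combination of indicators of events
    [s <= X], and the moment of order [2 + nu] pays for mesh and truncation. *)

Section square_integrable.
Context {R : realType} {d : measure_display} {T : measurableType d}.
Variable P : probability T R.
Implicit Types (f g h : T -> R) (a b : R).

Definition rint f := P.-integrable setT (EFin \o f).

Definition sqint f :=
  measurable_fun setT f /\ rint (fun w => f w ^+ 2).

(** Real-valued, so that covariance identities reduce to [ring] and [lra]; meaningful for
    square-integrable arguments. *)
Definition cov f g : R :=
  \int[P]_w (f w * g w) - (\int[P]_w f w) * (\int[P]_w g w).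

Lemma rint_le f g : measurable_fun setT f -> rint g ->
  (forall w, `|f w| <= g w) -> rint f.
Proof.
move=> mf ig fg; apply: (le_integrable measurableT _ _ ig).
  exact/measurable_EFinP.
move=> w _ /=; rewrite lee_fin (le_trans (fg w))//; exact: ler_norm.
Qed.

Lemma rintD f g : rint f -> rint g -> rint (fun w => f w + g w).
Proof. by move=> fi gi; exact: (integrableD measurableT fi gi). Qed.

Lemma rintZ a f : rint f -> rint (fun w => a * f w).
Proof. by move=> fi; exact: (integrableZl measurableT a fi). Qed.

Lemma rint_meas f : rint f -> measurable_fun setT f.
Proof. by move=> /measurable_int /measurable_EFinP. Qed.

Lemma rint_cst a : rint (cst a).
Proof. exact: finite_measure_integrable_cst. Qed.

Lemma rint_sum (I : Type) (s : seq I) (F : I -> T -> R) :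
  (forall i, rint (F i)) -> rint (fun w => \sum_(i <- s) F i w).
Proof.
move=> Fi; elim: s => [|i s IH].
  apply: eq_integrable (rint_cst 0) => //= w _.
  by rewrite /= big_nil.
apply: eq_integrable (rintD (Fi i) IH) => //= w _.
by rewrite /= big_cons.
Qed.

Lemma mean_cst a : \int[P]_w a = a.
Proof.
rewrite Rintegral_cst// -[RHS]mulr1; congr (_ * _).
by rewrite -[RHS]/(fine 1%E); congr fine; exact: probability_setT.
Qed.

Lemma meanD f g : rint f -> rint g ->
  \int[P]_w (f w + g w) = \int[P]_w f w + \int[P]_w g w.
Proof. by move=> fi gi; rewrite RintegralD. Qed.

Lemma meanZ a f : rint f -> \int[P]_w (a * f w) = a * \int[P]_w f w.
Proof. by move=> fi; rewrite RintegralZl. Qed.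

Lemma mean_le f g : rint f -> rint g -> (forall w, f w <= g w) ->
  \int[P]_w f w <= \int[P]_w g w.
Proof. by move=> fi gi fg; apply: le_Rintegral. Qed.

Lemma mean_sum (I : Type) (s : seq I) (F : I -> T -> R) :
  (forall i, rint (F i)) ->
  \int[P]_w (\sum_(i <- s) F i w) = \sum_(i <- s) \int[P]_w F i w.
Proof.
move=> Fi; elim: s => [|i s IH].
  rewrite big_nil -[RHS](mean_cst 0); apply: eq_Rintegral => w _.
  by rewrite big_nil.
rewrite big_cons -IH -meanD//; last exact: rint_sum.
by apply: eq_Rintegral => w _; rewrite big_cons.
Qed.

Lemma sqint_mul f g : sqint f -> sqint g -> rint (fun w => f w * g w).
Proof.
move=> [mf fi] [mg gi]; apply: (rint_le _ (rintD fi gi)) => [|w /=].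
  exact: measurable_funM.
by rewrite ler_norml; apply/andP; split; nra.
Qed.

Lemma sqint_cst a : sqint (cst a).
Proof. by split; [exact: measurable_cst|exact: (rint_cst (a ^+ 2))]. Qed.

Lemma sqint_rint f : sqint f -> rint f.
Proof.
move=> sf; apply: eq_integrable (sqint_mul sf (sqint_cst 1)) => //= w _.
by rewrite /= mulr1.
Qed.

Lemma sqint_le f g : measurable_fun setT f -> rint g ->
  (forall w, f w ^+ 2 <= g w) -> sqint f.
Proof.
move=> mf ig fg; split => //; apply: (rint_le _ ig) => [|w].
  exact: measurable_funX.
by rewrite ger0_norm// sqr_ge0.
Qed.

Lemma sqintD f g : sqint f -> sqint g -> sqint (fun w => f w + g w).
Proof.
move=> [mf fi] [mg gi].
apply: (sqint_le _ (rintD (rintZ 2 fi) (rintZ 2 gi))) => [|w /=].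
  exact: measurable_funD.
by rewrite -subr_ge0 (_ : _ - _ = (f w - g w) ^+ 2) ?sqr_ge0//; ring.
Qed.

Lemma sqintZ a f : sqint f -> sqint (fun w => a * f w).
Proof.
move=> [mf fi]; apply: (sqint_le _ (rintZ (a ^+ 2) fi)) => [|w /=].
  exact: measurable_funM.
by rewrite exprMn.
Qed.

Lemma sqint_sum (I : Type) (s : seq I) (F : I -> T -> R) :
  (forall i, sqint (F i)) -> sqint (fun w => \sum_(i <- s) F i w).
Proof.
move=> Fi; elim: s => [|i s IH].
  rewrite (_ : (fun _ => _) = cst 0); first exact: sqint_cst.
  by apply/funext => w; rewrite big_nil.
rewrite (_ : (fun _ => _) = (fun w => F i w + \sum_(j <- s) F j w)).
  exact: sqintD.
by apply/funext => w; rewrite big_cons.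
Qed.

Lemma covC f g : cov f g = cov g f.
Proof.
rewrite /cov mulrC; congr (_ - _); apply: eq_Rintegral => w _.
exact: mulrC.
Qed.

Lemma covDl f g h : sqint f -> sqint g -> sqint h ->
  cov (fun w => f w + g w) h = cov f h + cov g h.
Proof.
move=> sf sg sh; rewrite /cov meanD; try exact: sqint_rint.
rewrite (@eq_Rintegral _ _ _ _ _ (fun w => f w * h w + g w * h w)); last first.
  by move=> w _; exact: mulrDl.
rewrite meanD; try exact: sqint_mul.
by ring.
Qed.

Lemma covZl a f h : sqint f -> sqint h ->
  cov (fun w => a * f w) h = a * cov f h.
Proof.
move=> sf sh; rewrite /cov meanZ; last exact: sqint_rint.
rewrite (@eq_Rintegral _ _ _ _ _ (fun w => a * (f w * h w))); last first.
  by move=> w _; rewrite mulrA.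
rewrite meanZ; last exact: sqint_mul.
by ring.
Qed.

Lemma cov_cstl a h : sqint h -> cov (cst a) h = 0.
Proof.
move=> sh; rewrite /cov mean_cst meanZ; last exact: sqint_rint.
by rewrite subrr.
Qed.

Lemma cov_suml (I : Type) (s : seq I) (F : I -> T -> R) h :
  (forall i, sqint (F i)) -> sqint h ->
  cov (fun w => \sum_(i <- s) F i w) h = \sum_(i <- s) cov (F i) h.
Proof.
move=> Fi sh; elim: s => [|i s IH].
  rewrite big_nil (_ : (fun _ => _) = cst 0) ?cov_cstl//.
  by apply/funext => w; rewrite big_nil.
rewrite big_cons -IH -covDl//; last exact: sqint_sum.
by congr cov; apply/funext => w; rewrite big_cons.
Qed.

Lemma mean_sqr_le f : sqint f ->
  (\int[P]_w f w) ^+ 2 <= \int[P]_w (f w ^+ 2).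
Proof.
move=> sf; set m := \int[P]_w f w.
have sg : sqint (fun w => f w + - m) by apply: sqintD => //; exact: sqint_cst.
have : 0 <= \int[P]_w ((f w + - m) ^+ 2).
  by apply: Rintegral_ge0 => w _; exact: sqr_ge0.
have i1 : rint (fun w => - (2 * m) * f w) by exact/rintZ/sqint_rint.
have i2 : rint (fun w => - (2 * m) * f w + m ^+ 2).
  exact: rintD i1 (rint_cst _).
rewrite (@eq_Rintegral _ _ _ _ _
  (fun w => f w ^+ 2 + (- (2 * m) * f w + m ^+ 2))); last first.
  by move=> w _; rewrite /=; ring.
rewrite meanD//; last exact: sf.2.
rewrite meanD//; last exact: rint_cst.
rewrite meanZ; last exact: sqint_rint.
by rewrite mean_cst -/m; nra.
Qed.

(** Weighted AM-GM, applied once under the integral and once to the product of the means; each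
    contributes half. The free weight [l] serves to balance a small second moment against one of
    order 1. *)
Lemma cov_le l f g : 0 < l -> sqint f -> sqint g ->
  `|cov f g| <= l * \int[P]_w (f w ^+ 2) + l^-1 * \int[P]_w (g w ^+ 2).
Proof.
move=> l0 sf sg; rewrite /cov.
have amgm x y : `|x * y| <= 2^-1 * (l * x ^+ 2 + l^-1 * y ^+ 2).
  have li : l * l^-1 = 1 by rewrite mulfV// gt_eqF.
  have l1 : 0 < l^-1 by rewrite invr_gt0.
  have h1 : 0 <= l^-1 * (l * x - y) ^+ 2 by rewrite mulr_ge0 ?sqr_ge0 ?ltW.
  have h2 : 0 <= l^-1 * (l * x + y) ^+ 2 by rewrite mulr_ge0 ?sqr_ge0 ?ltW.
  have e1 : l^-1 * (l * x - y) ^+ 2 =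
     (l * l^-1) * l * x ^+ 2 - 2 * (l * l^-1) * x * y + l^-1 * y ^+ 2 by ring.
  have e2 : l^-1 * (l * x + y) ^+ 2 =
     (l * l^-1) * l * x ^+ 2 + 2 * (l * l^-1) * x * y + l^-1 * y ^+ 2 by ring.
  rewrite li in e1 e2.
  by rewrite ler_norml; apply/andP; split; lra.
have h1 : `|\int[P]_w (f w * g w)| <=
    2^-1 * (l * \int[P]_w (f w ^+ 2) + l^-1 * \int[P]_w (g w ^+ 2)).
  apply: (le_trans (le_normr_Rintegral measurableT (sqint_mul sf sg))).
  rewrite -!meanZ; [|exact: sg.2|exact: sf.2].
  rewrite -meanD; [|exact/rintZ/sf.2|exact/rintZ/sg.2].
  rewrite -meanZ; last by apply: rintD; apply: rintZ; [exact: sf.2|exact: sg.2].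
  apply: mean_le => //.
    exact: integrable_norm (sqint_mul sf sg).
  by apply/rintZ/rintD; apply: rintZ; [exact: sf.2|exact: sg.2].
have h2 := amgm (\int[P]_w f w) (\int[P]_w g w).
have h3 : l * (\int[P]_w f w) ^+ 2 <= l * \int[P]_w (f w ^+ 2).
  by rewrite ler_pM2l ?mean_sqr_le.
have h4 : l^-1 * (\int[P]_w g w) ^+ 2 <= l^-1 * \int[P]_w (g w ^+ 2).
  by rewrite ler_pM2l ?mean_sqr_le ?invr_gt0.
apply: (le_trans (ler_normB _ _)).
lra.
Qed.

End square_integrable.

(** * Partial sums along the squares *)

Section square_blocks.
Context {R : realType}.
Implicit Types z : nat -> R.

(** There are [2 q + 1] indices from [q ^ 2] up to but excluding [(q + 1) ^ 2]; the absolute values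
    make the sum dominate every partial sum that starts at [q ^ 2] and stays in the gap. *)
Definition block z q : R := \sum_(i < q.*2.+1) `|z (q ^ 2 + i)%N|.

Definition block_energy z q0 N : R :=
  \sum_(q0 <= q < N)
    ((\sum_(i < q ^ 2) z i) ^+ 2 + block z q ^+ 2) / q%:R ^+ 4.

Lemma nat_sqrt m : exists q, (q ^ 2 <= m < q.+1 ^ 2)%N.
Proof.
elim: m => [|m [q /andP[qm mq]]]; first by exists 0%N.
have [h|h] := ltnP m.+1 (q.+1 ^ 2).
  by exists q; rewrite h (leq_trans qm).
exists q.+1; rewrite h /=; apply: (leq_ltn_trans mq).
by rewrite ltn_exp2r.
Qed.

Lemma block_energy_ge0 z q0 N : 0 <= block_energy z q0 N.
Proof.
apply: sumr_ge0 => q _; rewrite divr_ge0 ?exprn_ge0 ?ler0n//.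
by rewrite addr_ge0 ?sqr_ge0.
Qed.

(** If the claim fails at some [m] between [q ^ 2] and [(q + 1) ^ 2], then
    [e q ^ 2 < |S_(q^2)| + T_q]. As [(x + y) ^ 2 <= 2 (x ^ 2 + y ^ 2)], the single term of index [q]
    already exceeds [e ^ 2 / 2]. *)
Lemma block_energy_small z q0 N e m : (0 < q0)%N -> 0 < e ->
  block_energy z q0 N < e ^+ 2 / 2 ->
  (q0 ^ 2 <= m < N ^ 2)%N -> `|\sum_(i < m) z i| <= e * m%:R.
Proof.
move=> q00 e0 small /andP[qm mN]; rewrite leNgt; apply/negP => big.
have [q /andP[q1 q2]] := nat_sqrt m.
have q0q : (q0 <= q)%N.
  by rewrite -ltnS -(@ltn_exp2r _ _ 2)//; exact: leq_ltn_trans q2.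
have qN : (q < N)%N by rewrite -(@ltn_exp2r _ _ 2)//; exact: leq_ltn_trans mN.
have q_gt0 : (0 < q)%N by exact: leq_trans q0q.
set S := \sum_(i < q ^ 2) z i.
have SB : `|\sum_(i < m) z i| <= `|S| + block z q.
  rewrite -(subnKC q1) big_split_ord /= (le_trans (ler_normD _ _))// lerD2l.
  rewrite (le_trans (ler_norm_sum _ _ _))// /block.
  rewrite -(big_mkord predT (fun i => `|z (q ^ 2 + i)%N|)).
  rewrite -(big_mkord predT (fun i => `|z (q ^ 2 + i)%N|)).
  have h : (m - q ^ 2 <= q.*2.+1)%N.
    rewrite leq_subLR -ltnS (leq_trans q2)//; lia.
  rewrite [leRHS](big_cat_nat (leq0n _) h)/= lerDl.
  by apply: sumr_ge0.
have B0 : 0 <= block z q by apply: sumr_ge0.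
have qR : 0 < (q%:R : R) by rewrite ltr0n.
have q4 : 0 < (q%:R : R) ^+ 4 by rewrite exprn_gt0.
have eq : e * q%:R ^+ 2 < `|S| + block z q.
  apply: lt_le_trans SB; apply: le_lt_trans big.
  by rewrite ler_pM2l// -natrX ler_nat.
have : (S ^+ 2 + block z q ^+ 2) / q%:R ^+ 4 <= block_energy z q0 N.
  rewrite /block_energy (bigD1_seq q) ?iota_uniq ?mem_index_iota ?q0q//= lerDl.
  apply: sumr_ge0 => i _; rewrite divr_ge0 ?exprn_ge0 ?ler0n//.
  by rewrite addr_ge0 ?sqr_ge0.
move=> /le_lt_trans /(_ small); rewrite ltr_pdivrMr// => lt1.
have lt2 : (e * q%:R ^+ 2) ^+ 2 < (`|S| + block z q) ^+ 2.
  by rewrite ltr_pXn2r// ?nnegrE ?addr_ge0// mulr_ge0 ?ltW// exprn_gt0.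
have e1 : (e * q%:R ^+ 2) ^+ 2 = e ^+ 2 * q%:R ^+ 4 by ring.
have e2 : S ^+ 2 = `|S| ^+ 2 by rewrite real_normK ?num_real.
have h := sqr_ge0 (`|S| - block z q).
rewrite e1 in lt2; rewrite e2 in lt1.
have e3 : e ^+ 2 / 2 * q%:R ^+ 4 = (e ^+ 2 * q%:R ^+ 4) / 2 by ring.
rewrite e3 in lt1.
have e4 : (`|S| + block z q) ^+ 2 =
  2 * (`|S| ^+ 2 + block z q ^+ 2) - (`|S| - block z q) ^+ 2 by ring.
rewrite e4 in lt2.
lra.
Qed.

Lemma sum_inv_sqr q0 N : (0 < q0)%N ->
  \sum_(q0 <= q < N) (q%:R ^+ 2)^-1 <= 2 / q0%:R :> R.
Proof.
move=> q00; have [h|h] := leqP N q0.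
  by rewrite big_geq// divr_ge0.
(* The subtracted [2 / N] makes the induction close: [1 / N ^ 2 <= 2 / N - 2 / (N + 1)] for
   [N >= 1]. *)
suff: \sum_(q0 <= q < N) (q%:R ^+ 2)^-1 <= 2 / q0%:R - 2 / N%:R :> R.
  by move=> /le_trans; apply; rewrite gerBl divr_ge0.
elim: N h => // N IH; rewrite ltnS leq_eqVlt => /predU1P[<-|h].
  rewrite big_nat1 -(subr_ge0).
  have q1 : (1 : R) <= q0%:R by rewrite ler1n.
  have -> : 2 / q0%:R - 2 / q0.+1%:R - (q0%:R ^+ 2)^-1 =
     (q0%:R - 1) / (q0%:R ^+ 2 * q0.+1%:R) :> R.
    by rewrite -natr1; field; apply/andP; split; lra.
  by rewrite divr_ge0 ?mulr_ge0 ?exprn_ge0 ?ler0n// subr_ge0.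
rewrite big_nat_recr/=; last exact: ltnW.
have IH' := IH h.
have q1 : (1 : R) <= N%:R by rewrite ler1n; exact: leq_ltn_trans h.
have : 0 <= 2 / N%:R - 2 / N.+1%:R - (N%:R ^+ 2)^-1 :> R.
  have -> : 2 / N%:R - 2 / N.+1%:R - (N%:R ^+ 2)^-1 =
     (N%:R - 1) / (N%:R ^+ 2 * N.+1%:R) :> R.
    by rewrite -natr1; field; apply/andP; split; lra.
  by rewrite divr_ge0 ?mulr_ge0 ?exprn_ge0 ?ler0n// subr_ge0.
move: IH'; move: (\sum_(_ <= _ < _) _) (2 / q0%:R : R) (2 / N%:R : R).
by move: (2 / N.+1%:R : R) (N%:R ^- 2 : R) => c x s a b; lra.
Qed.

Lemma geometric_sum_le (r : R) m : 0 <= r < 1 ->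
  \sum_(i < m.+1) r ^+ (m - i) <= (1 - r)^-1.
Proof.
move=> /andP[r0 r1]; elim: m => [|m IH].
  rewrite big_ord1 expr0 invf_ge1; lra.
rewrite big_ord_recr/= subnn expr0.
have -> : \sum_(i < m.+1) r ^+ (m.+1 - i) = r * \sum_(i < m.+1) r ^+ (m - i).
  rewrite big_distrr; apply: eq_bigr => i _.
  by rewrite subSn ?exprS//= -ltnS.
have e : (1 - r)^-1 = 1 + r * (1 - r)^-1 by field; lra.
by rewrite [leRHS]e addrC lerD2l ler_wpM2l.
Qed.

End square_blocks.

(** * Mean of the block energy under geometric decay of the mixed moments *)

Section block_energy_mean.
Context {R : realType} {d : measure_display} {T : measurableType d}.
Variable P : probability T R.
Implicit Types (z : nat -> T -> R).

Lemma mean_sqr_sum_recr z n : (forall i, sqint P (z i)) ->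
  \int[P]_w ((\sum_(i < n.+1) z i w) ^+ 2) =
  \int[P]_w ((\sum_(i < n) z i w) ^+ 2) +
  (2 * (\sum_(i < n) \int[P]_w (z i w * z n w)) + \int[P]_w (z n w ^+ 2)).
Proof.
move=> sz.
have i1 : rint P (fun w => (\sum_(i < n) z i w) ^+ 2).
  by apply: (sqint_sum _ _).2 => i; exact: sz.
have i2 : rint P (fun w => \sum_(i < n) (z i w * z n w)).
  by apply: rint_sum => i; exact: sqint_mul.
have i3 := (sz n).2.
rewrite -mean_sum; last by move=> i; exact: sqint_mul.
rewrite -meanZ// -meanD//; last exact: rintZ.
rewrite -meanD//; last exact: rintD (rintZ _ _) _.
apply: eq_Rintegral => w _; rewrite big_ord_recr/= -big_distrl/=; ring.
Qed.

(** Each new index adds its own second moment and twice its mixed moments with the past, a geometric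
    series; altogether at most [2 V / (1 - r)]. *)
Lemma mean_sqr_sum_le z (V r : R) n : 0 <= V -> 0 <= r < 1 ->
  (forall i, sqint P (z i)) ->
  (forall i j, (i <= j)%N -> \int[P]_w (z i w * z j w) <= V * r ^+ (j - i)) ->
  \int[P]_w ((\sum_(i < n) z i w) ^+ 2) <= 2 * V / (1 - r) * n%:R.
Proof.
move=> V0 r01 sz zV; elim: n => [|n IH].
  rewrite mulr0 (@eq_Rintegral _ _ _ _ _ (fun=> 0)) ?mean_cst// => w _.
  by rewrite big_ord0 expr0n.
rewrite mean_sqr_sum_recr// -(natr1 n) mulrDr mulr1 lerD//.
have h1 : \int[P]_w (z n w ^+ 2) <= V.
  by have := zV n n (leqnn n); rewrite subnn expr0 mulr1.
have h2 : \sum_(i < n) \int[P]_w (z i w * z n w) <= V * (1 - r)^-1 - V.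
  rewrite lerBrDr; apply: (@le_trans _ _ (V * \sum_(i < n.+1) r ^+ (n - i))).
    rewrite big_ord_recr/= subnn expr0 mulrDr mulr1 lerD2r big_distrr/=.
    by apply: ler_sum => i _; apply: zV; exact: ltnW.
  by rewrite ler_wpM2l// geometric_sum_le.
have -> : 2 * V / (1 - r) = 2 * (V * (1 - r)^-1) by ring.
lra.
Qed.

(** Decay is lost once absolute values are taken, so only [2 x y <= x ^ 2 + y ^ 2] is used; a
    quadratic bound is affordable because gaps are short. *)
Lemma mean_sqr_block_le z (V : R) n : (forall i, sqint P (z i)) ->
  (forall i, \int[P]_w (z i w ^+ 2) <= V) ->
  \int[P]_w ((\sum_(i < n) z i w) ^+ 2) <= V * n%:R ^+ 2.
Proof.
move=> sz zV; elim: n => [|n IH].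
  rewrite expr0n mulr0 (@eq_Rintegral _ _ _ _ _ (fun=> 0)) ?mean_cst// => w _.
  by rewrite big_ord0 expr0n.
rewrite mean_sqr_sum_recr//.
have h : \sum_(i < n) \int[P]_w (z i w * z n w) <= V * n%:R.
  apply: (@le_trans _ _ (\sum_(i < n) V)); last first.
    by rewrite sumr_const card_ord mulr_natr.
  apply: ler_sum => i _.
  have i2 : rint P (fun w => 2^-1 * (z i w ^+ 2 + z n w ^+ 2)).
    by apply/rintZ/rintD; [exact: (sz i).2|exact: (sz n).2].
  apply: (@le_trans _ _ (\int[P]_w (2^-1 * (z i w ^+ 2 + z n w ^+ 2)))).
    apply: mean_le => // [|w]; first exact: sqint_mul.
    by have := sqr_ge0 (z i w - z n w); nra.
  rewrite meanZ; last by apply: rintD; [exact: (sz i).2|exact: (sz n).2].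
  rewrite meanD; [|exact: (sz i).2|exact: (sz n).2].
  by have := zV i; have := zV n; lra.
have := zV n.
have -> : V * n.+1%:R ^+ 2 = V * n%:R ^+ 2 + (2 * (V * n%:R) + V).
  by rewrite -(natr1 n); ring.
lra.
Qed.

(** The summand [2 / (1 - r)] comes from the sums up to [q ^ 2], the 9 from
    [(2 q + 1) ^ 2 <= 9 q ^ 2] in the gaps, and the last factor 2 from [sum_inv_sqr]. The bound is
    free of the cutoff [N]. *)
Lemma mean_block_energy z (V r : R) q0 N : (0 < q0)%N -> 0 <= V -> 0 <= r < 1 ->
  (forall i, sqint P (z i)) ->
  (forall i j, (i <= j)%N -> \int[P]_w (z i w * z j w) <= V * r ^+ (j - i)) ->
  rint P (fun w => block_energy (z ^~ w) q0 N) /\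
  \int[P]_w (block_energy (z ^~ w) q0 N) <= (2 / (1 - r) + 9) * V * 2 / q0%:R.
Proof.
move=> q00 V0 r01 sz zV.
have sa i : sqint P (fun w => `|z i w|).
  split; first by apply: measurableT_comp => //; exact: (sz i).1.
  apply: eq_integrable (sz i).2 => //= w _.
  by rewrite /= real_normK ?num_real.
have zV2 i : \int[P]_w (z i w ^+ 2) <= V.
  by have := zV i i (leqnn i); rewrite subnn expr0 mulr1.
have zaV i : \int[P]_w (`|z i w| ^+ 2) <= V.
  rewrite (@eq_Rintegral _ _ _ _ _ (fun w => z i w ^+ 2))//.
  by move=> w _; rewrite real_normK ?num_real.
have i1 q : rint P (fun w => (\sum_(i < q ^ 2) z i w) ^+ 2).
  by apply: (sqint_sum _ _).2 => i; exact: sz.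
have i2 q : rint P (fun w => block (z ^~ w) q ^+ 2).
  by apply: (sqint_sum _ _).2 => i; exact: sa.
have i3 q : rint P (fun w => (q%:R ^+ 4)^-1 *
    ((\sum_(i < q ^ 2) z i w) ^+ 2 + block (z ^~ w) q ^+ 2)).
  exact/rintZ/rintD.
have -> : (fun w => block_energy (z ^~ w) q0 N) =
   (fun w => \sum_(q0 <= q < N) (q%:R ^+ 4)^-1 *
    ((\sum_(i < q ^ 2) z i w) ^+ 2 + block (z ^~ w) q ^+ 2)).
  by apply/funext => w; apply: eq_bigr => q _; rewrite mulrC.
split; first by exact: rint_sum.
rewrite mean_sum//.
apply: (@le_trans _ _ (\sum_(q0 <= q < N)
    ((2 / (1 - r) + 9) * V) * (q%:R ^+ 2)^-1)); last first.
  rewrite -big_distrr/= -[leRHS]mulrA ler_wpM2l ?sum_inv_sqr// mulr_ge0//.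
  by rewrite addr_ge0// divr_ge0//; lra.
rewrite big_seq [leRHS]big_seq; apply: ler_sum => q.
rewrite mem_index_iota => /andP[q0q _].
have q1 : (1 : R) <= q%:R by rewrite ler1n (leq_trans q00).
rewrite meanZ; last exact: rintD.
rewrite meanD// mulrC ler_pdivrMr ?exprn_gt0//; last lra.
have -> : (2 / (1 - r) + 9) * V / q%:R ^+ 2 * q%:R ^+ 4 =
   2 * V / (1 - r) * q%:R ^+ 2 + V * 9 * q%:R ^+ 2.
  by field; lra.
apply: lerD.
  by rewrite -natrX; exact: mean_sqr_sum_le.
have := @mean_sqr_block_le (fun i w => `|z (q ^ 2 + i)%N w|) V q.*2.+1
  (fun i => sa _) (fun i => zaV _).
move=> /le_trans; apply; rewrite -mulrA ler_wpM2l//.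
have -> : (q.*2.+1%:R : R) = 2 * q%:R + 1 by rewrite -(natr1 q.*2) -mul2n natrM.
nra.
Qed.

End block_energy_mean.

(** * Covariance decay under phi-mixing *)

Section staircase.
Context {R : realType}.
Implicit Types (x y h : R).

(** The integer part of [y] clipped to [[0, K]], written as a sum of indicators so that covariances
    expand by bilinearity. *)
Definition steps K y : R := \sum_(i < K) (i.+1%:R <= y)%R%:R.

(* [h] times the integer part of [x / h], truncated to [-N, N]. *)
Definition stair h N x : R := h * (steps N.*2 (x / h + N%:R) - N%:R).

Lemma steps_lt1 K y : y < 1 -> steps K y = 0.
Proof.
move=> y1; apply: big1 => i _; have [h|//] := leP i.+1%:R y.
by have := le_lt_trans h y1; rewrite ltNge ler1n.
Qed.

Lemma steps_ge K y : K%:R <= y -> steps K y = K%:R.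
Proof.
move=> Ky; rewrite /steps (eq_bigr (fun=> 1)) ?sumr_const ?card_ord// => i _.
by rewrite (le_trans _ Ky)// ler_nat.
Qed.

Lemma steps_itv K y : 0 <= y <= K%:R -> steps K y <= y <= steps K y + 1.
Proof.
elim: K => [|K IH] /andP[y0].
  move=> yK; have -> : y = 0 by apply/eqP; rewrite eq_le yK.
  by rewrite /steps big_ord0 lexx add0r ler01.
move=> yK1; rewrite /steps big_ord_recr/= -/(steps K y).
have [yK|Ky] := leP y K%:R.
  have /andP[h1 h2] : steps K y <= y <= steps K y + 1 by rewrite IH// y0.
  have -> : (K.+1%:R <= y) = false.
    by apply/negbTE; rewrite -ltNge (le_lt_trans yK)// ltr_nat.
  by rewrite addr0 h1.
rewrite steps_ge; last exact: ltW.
have [h|h] := leP K.+1%:R y.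
  by rewrite mulr1n natr1 h (le_trans yK1)// lerDl.
by rewrite mulr0n addr0 natr1 (ltW Ky) (ltW h).
Qed.

Lemma stair_near h N x : 0 < h -> `|x| <= N%:R * h -> `|x - stair h N x| <= h.
Proof.
move=> h0 xN; set y := x / h + N%:R.
have xy : x = h * (y - N%:R) by rewrite addrK mulrC divfK// gt_eqF.
have : 0 <= y <= N.*2%:R.
  move: xN; rewrite -ler_pdivrMr// -[h in _ / h]gtr0_norm// -normf_div.
  by rewrite ler_norml -addnn natrD /y => /andP[? ?]; apply/andP; split; lra.
move=> /steps_itv/andP[h1 h2].
rewrite {1}xy /stair -/y -mulrBr normrM gtr0_norm// ger_pMr//.
by rewrite ger0_norm; lra.
Qed.

Lemma stair_far h N x : 0 < h -> N%:R * h < `|x| -> `|x - stair h N x| <= `|x|.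
Proof.
move=> h0; have N0 : 0 <= N%:R * h by rewrite mulr_ge0// ltW.
rewrite lter_normr => /orP[xN|xN].
  have e : stair h N x = N%:R * h.
    rewrite /stair steps_ge; last first.
      by rewrite -addnn natrD lerD2r ler_pdivlMr// ltW.
    by rewrite -addnn natrD addrK mulrC.
  by rewrite e !ger0_norm; lra.
have e : stair h N x = - (N%:R * h).
  rewrite /stair steps_lt1; last first.
    have : x / h < - N%:R by rewrite ltr_pdivrMr//; lra.
    lra.
  by rewrite sub0r mulrN mulrC.
by rewrite e !ler0_norm; lra.
Qed.

(** Below the height [N h] the error is one mesh. Above it the error is at most [|x|], and [|x| ^ 2]
    is [|x| ^ (2 + nu)] divided by [|x| ^ nu > (N h) ^ nu]. *)
Lemma stair_sqr h N x nu : 0 < h -> (0 < N)%N -> 0 < nu ->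
  (x - stair h N x) ^+ 2 <=
  h ^+ 2 + ((N%:R * h) `^ nu)^-1 * (`|x| `^ (2 + nu)).
Proof.
move=> h0 N0 nu0; have T0 : 0 < N%:R * h by rewrite mulr_gt0 ?ltr0n.
rewrite -[leLHS]real_normK ?num_real//.
have [xT|Tx] := leP `|x| (N%:R * h).
  apply: ler_wpDr; first by rewrite mulr_ge0 ?invr_ge0 ?powR_ge0.
  by rewrite ler_pXn2r ?nnegrE ?stair_near// ltW.
apply: ler_wpDl; first by rewrite exprn_ge0// ltW.
apply: (@le_trans _ _ (`|x| ^+ 2)).
  by rewrite ler_pXn2r ?nnegrE ?stair_far.
have x0 : 0 < `|x| by exact: lt_trans Tx.
rewrite ler_pdivlMl ?powR_gt0//.
rewrite powRD; last by rewrite (gt_eqF x0) implybT.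
rewrite -powR_mulrn// mulrC ler_wpM2l ?powR_ge0//.
by apply: ge0_ler_powR; rewrite ?nnegrE; apply: ltW.
Qed.

Lemma sqr_le_moment x nu : 0 < nu -> x ^+ 2 <= 1 + `|x| `^ (2 + nu).
Proof.
move=> nu0; rewrite -[leLHS]real_normK ?num_real//.
have [x1|x1] := leP `|x| 1.
  by rewrite ler_wpDr ?powR_ge0// expr_le1.
apply: ler_wpDl => //; rewrite -powR_mulrn//.
by apply: ler_powR; rewrite ?lerDl; apply: ltW.
Qed.

End staircase.

(** * A covariance inequality from the dependence of level events *)

Section mixing_covariance.
Context {R : realType} {d : measure_display} {T : measurableType d}.
Variable P : probability T R.
Implicit Types (X Y : T -> R).

Definition tail_dependence X Y (s t : R) : R :=
  fine (P ([set w | s <= X w] `&` [set w | t <= Y w])) -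
  fine (P [set w | s <= X w]) * fine (P [set w | t <= Y w]).

Lemma measurable_ge X (s : R) :
  measurable_fun setT X -> measurable [set w | s <= X w].
Proof.
move=> mX; rewrite -[X in measurable X]setTI.
rewrite (_ : [set w | _] = X @^-1` `[s, +oo[); first exact: mX.
by apply/seteqP; split => w /=; rewrite in_itv/= andbT.
Qed.

Lemma mean_indic (A : set T) : measurable A -> \int[P]_w (\1_A w) = fine (P A).
Proof.
by move=> mA; rewrite /Rintegral integral_indic// setIT.
Qed.

Lemma sqint_indic_ge X s : measurable_fun setT X ->
  sqint P (fun w => (s <= X w)%R%:R).
Proof.
move=> mX; apply: (sqint_le _ (rint_cst P 1)) => [|w /=]; last first.
  by case: (s <= X w); rewrite ?expr1n ?expr0n.
rewrite (_ : (fun _ => _) = \1_[set w | s <= X w]); last first.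
  by apply/funext => w; rewrite indicE mem_setE.
exact/measurable_indic/measurable_ge.
Qed.

Lemma cov_indic_ge X Y s t : measurable_fun setT X -> measurable_fun setT Y ->
  cov P (fun w => (s <= X w)%R%:R) (fun w => (t <= Y w)%R%:R) =
  tail_dependence X Y s t.
Proof.
move=> mX mY; have mA := measurable_ge s mX; have mB := measurable_ge t mY.
rewrite /cov /tail_dependence -!mean_indic//; last exact: measurableI.
congr (_ - _ * _); apply: eq_Rintegral => w _; rewrite ?indicE ?mem_setE//=.
rewrite in_setI !mem_setE/=.
by rewrite -natrM mulnb.
Qed.

Lemma sqint_stair h N X : measurable_fun setT X ->
  sqint P (fun w => stair h N (X w)).
Proof.
move=> mX; apply: sqintZ; apply: sqintD; last exact: (sqint_cst P (- N%:R)).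
apply: sqint_sum => i; apply: sqint_indic_ge.
by apply: measurable_funD => //; exact: measurable_funM.
Qed.

(** Each staircase is [h] times a sum of [2 N] indicators, up to a constant that covariance ignores;
    the [(2 N) ^ 2] pairs contribute at most [phi] each. *)
Lemma cov_stair_le (h : R) N X Y (phi : R) : 0 < h ->
  measurable_fun setT X -> measurable_fun setT Y ->
  (forall s t, `|tail_dependence X Y s t| <= phi) ->
  `|cov P (fun w => stair h N (X w)) (fun w => stair h N (Y w))|
    <= (2 * (N%:R * h)) ^+ 2 * phi.
Proof.
move=> h0 mX mY dep.
pose u (Z : T -> R) (i : nat) (w : T) : R := ((i.+1%:R - N%:R) * h <= Z w)%R%:R.
have uE (Z : T -> R) : (fun w => stair h N (Z w)) =
    (fun w => h * (\sum_(i < N.*2) u Z i w + - N%:R)).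
  apply/funext => w; congr (_ * (_ - _)); apply: eq_bigr => i _.
  by rewrite -lerBlDr ler_pdivlMr.
have su (Z : T -> R) i : measurable_fun setT Z -> sqint P (u Z i).
  by move=> mZ; exact: sqint_indic_ge.
have ss (Z : T -> R) : measurable_fun setT Z ->
    sqint P (fun w => \sum_(i < N.*2) u Z i w).
  by move=> mZ; apply: sqint_sum => i; exact: su.
have sN : sqint P (fun=> - N%:R) by exact: (sqint_cst P (- N%:R)).
have sd (Z : T -> R) : measurable_fun setT Z ->
    sqint P (fun w => \sum_(i < N.*2) u Z i w + - N%:R).
  by move=> mZ; apply: sqintD => //; exact: ss.
have st (Z : T -> R) : measurable_fun setT Z ->
    sqint P (fun w => h * (\sum_(i < N.*2) u Z i w + - N%:R)).
  by move=> mZ; apply: sqintZ; exact: sd.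
rewrite !uE covZl; [|exact: sd|exact: st].
rewrite (covDl (ss _ mX) sN (st _ mY)) (cov_cstl (- N%:R) (st _ mY)) addr0.
rewrite covC covZl; [|exact: sd|exact: ss].
rewrite (covDl (ss _ mY) sN (ss _ mX)) (cov_cstl (- N%:R) (ss _ mX)) addr0.
rewrite cov_suml; [|by move=> i; exact: su|exact: ss].
rewrite mulrA normrM -expr2 (ger0_norm (exprn_ge0 _ (ltW h0))).
have -> : (2 * (N%:R * h)) ^+ 2 * phi = h ^+ 2 * (N.*2%:R * (N.*2%:R * phi)).
  by rewrite -addnn natrD; ring.
rewrite ler_pM2l ?exprn_gt0//; apply: (le_trans (ler_norm_sum _ _ _)).
apply: (@le_trans _ _ (\sum_(i < N.*2) N.*2%:R * phi)); last first.
  by rewrite sumr_const card_ord -[leLHS]mulr_natl.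
apply: ler_sum => i _; rewrite covC cov_suml; [|by move=> j; exact: su|exact: su].
apply: (le_trans (ler_norm_sum _ _ _)).
apply: (@le_trans _ _ (\sum_(i < N.*2) phi)); last first.
  by rewrite sumr_const card_ord -[leLHS]mulr_natl.
by apply: ler_sum => j _; rewrite cov_indic_ge.
Qed.

Lemma mean_sqr_stair X (h : R) N (nu K : R) : 0 < h -> (0 < N)%N -> 0 < nu ->
  measurable_fun setT X -> rint P (fun w => `|X w| `^ (2 + nu)) ->
  \int[P]_w (`|X w| `^ (2 + nu)) <= K ->
  sqint P (fun w => X w + - stair h N (X w)) /\
  \int[P]_w ((X w + - stair h N (X w)) ^+ 2) <=
    h ^+ 2 + ((N%:R * h) `^ nu)^-1 * K.
Proof.
move=> h0 N0 nu0 mX iX XK.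
have i1 : rint P (fun w => h ^+ 2 + ((N%:R * h) `^ nu)^-1 * (`|X w| `^ (2 + nu))).
  exact: (rintD (rint_cst P (h ^+ 2)) (rintZ _ iX)).
have sX : sqint P (fun w => X w + - stair h N (X w)).
  apply: sqint_le i1 _ => [|w]; last exact: stair_sqr.
  by apply: measurable_funB => //; exact: (sqint_stair h N mX).1.
split => //; apply: (@le_trans _ _
   (\int[P]_w (h ^+ 2 + ((N%:R * h) `^ nu)^-1 * (`|X w| `^ (2 + nu))))).
  by apply: mean_le => // [|w]; [exact: sX.2|exact: stair_sqr].
rewrite meanD ?mean_cst; [|exact: (rint_cst P (h ^+ 2))|exact: rintZ].
by rewrite lerD2l meanZ// ler_wpM2l// invr_ge0 powR_ge0.
Qed.

Lemma mean_sqr_moment X (nu K : R) : 0 < nu ->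
  measurable_fun setT X -> rint P (fun w => `|X w| `^ (2 + nu)) ->
  \int[P]_w (`|X w| `^ (2 + nu)) <= K ->
  sqint P X /\ \int[P]_w (X w ^+ 2) <= 1 + K.
Proof.
move=> nu0 mX iX XK.
have i1 : rint P (fun w => 1 + (`|X w| `^ (2 + nu))).
  exact: (rintD (rint_cst P 1) iX).
have sX : sqint P X by apply: sqint_le i1 _ => // w; exact: sqr_le_moment.
split => //; apply: (@le_trans _ _ (\int[P]_w (1 + `|X w| `^ (2 + nu)))).
  by apply: mean_le => // [|w]; [exact: sX.2|exact: sqr_le_moment].
by rewrite meanD ?mean_cst; [lra|exact: (rint_cst P 1)|exact: iX].
Qed.

(** With staircases [U], [V] of [X], [Y], the covariance splits into those of [(U, V)], [(U, Y - V)]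
    and [(X - U, Y)]. For the last two, [cov_le] with weight [1 / h] balances [h ^ 2 Q] against
    [4 Q] and [Q], giving [5 h Q] and [2 h Q]. *)
Lemma mixing_cov_stair X Y (h phi Q : R) N : 0 < h <= 1 -> 0 <= Q ->
  sqint P X -> sqint P Y ->
  \int[P]_w (X w ^+ 2) <= Q -> \int[P]_w (Y w ^+ 2) <= Q ->
  \int[P]_w ((X w + - stair h N (X w)) ^+ 2) <= h ^+ 2 * Q ->
  \int[P]_w ((Y w + - stair h N (Y w)) ^+ 2) <= h ^+ 2 * Q ->
  (forall s t, `|tail_dependence X Y s t| <= phi) ->
  `|cov P X Y| <= (2 * (N%:R * h)) ^+ 2 * phi + 7 * (h * Q).
Proof.
move=> /andP[h0 h1] Q0 sX sY X2 Y2 X' Y' dep.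
have sU := sqint_stair h N sX.1; have sV := sqint_stair h N sY.1.
have sX' : sqint P (fun w => X w + - stair h N (X w)).
  apply: sqintD => //; rewrite (_ : (fun _ => _) =
    (fun w => -1 * stair h N (X w))); first exact: sqintZ.
  by apply/funext => w; rewrite mulN1r.
have sY' : sqint P (fun w => Y w + - stair h N (Y w)).
  apply: sqintD => //; rewrite (_ : (fun _ => _) =
    (fun w => -1 * stair h N (Y w))); first exact: sqintZ.
  by apply/funext => w; rewrite mulN1r.
(* From [U = X - (X - U)], both parts having second moment at most [Q] because [h <= 1]. *)
have U2 : \int[P]_w (stair h N (X w) ^+ 2) <= 4 * Q.
  apply: (@le_trans _ _
    (\int[P]_w (2 * X w ^+ 2 + 2 * (X w + - stair h N (X w)) ^+ 2))).
    apply: mean_le; [exact: sU.2| |move=> w].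
      by apply: rintD; apply: rintZ; [exact: sX.2|exact: sX'.2].
    rewrite -subr_ge0 (_ : _ - _ = (2 * X w - stair h N (X w)) ^+ 2).
      exact: sqr_ge0.
    by ring.
  rewrite meanD; [|exact/rintZ/sX.2|exact/rintZ/sX'.2].
  rewrite !meanZ; [|exact: sX'.2|exact: sX.2].
  have -> : 4 * Q = 2 * Q + 2 * Q by ring.
  apply: lerD; rewrite ler_pM2l//; apply: (le_trans X').
  by rewrite ler_piMl// exprn_ile1// ltW.
have eX : cov P X Y = cov P (fun w => stair h N (X w)) Y +
    cov P (fun w => X w + - stair h N (X w)) Y.
  rewrite -covDl//; congr cov; apply/funext => w.
  by rewrite addrC subrK.
have eY : cov P (fun w => stair h N (X w)) Y =
   cov P (fun w => stair h N (X w)) (fun w => stair h N (Y w)) +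
   cov P (fun w => stair h N (X w)) (fun w => Y w + - stair h N (Y w)).
  rewrite ![cov _ (fun w => stair h N (X w)) _]covC -covDl//.
  congr cov; apply/funext => w.
  by rewrite addrC subrK.
have hi0 : 0 < h^-1 by rewrite invr_gt0.
have e1 : h^-1 * (h ^+ 2 * Q) = h * Q by rewrite expr2 !mulrA mulVf ?gt_eqF ?mul1r.
have l1 : `|cov P (fun w => X w + - stair h N (X w)) Y| <= h * Q + h * Q.
  apply: le_trans (cov_le hi0 sX' sY) _; rewrite invrK.
  by apply: lerD; [rewrite -e1 ler_pM2l|rewrite ler_pM2l].
have l2 : `|cov P (fun w => stair h N (X w)) (fun w => Y w + - stair h N (Y w))|
    <= h * Q + h * (4 * Q).
  rewrite covC; apply: le_trans (cov_le hi0 sY' sU) _; rewrite invrK.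
  by apply: lerD; [rewrite -e1 ler_pM2l|rewrite ler_pM2l].
have l3 := cov_stair_le N h0 sX.1 sY.1 dep.
rewrite eX eY; apply: (le_trans (ler_normD _ _)).
apply: (le_trans (lerD (ler_normD _ _) (lexx _))).
have -> : (2 * (N%:R * h)) ^+ 2 * phi + 7 * (h * Q) =
  (2 * (N%:R * h)) ^+ 2 * phi + (h * Q + h * (4 * Q)) + (h * Q + h * Q) by ring.
by rewrite !lerD.
Qed.

(** Only the geometric form of the rate matters later, so [r] is chosen for convenience; what counts
    is that [C] and [r] are fixed before the variables and the lag. *)
Lemma mixing_cov (a nu K : R) : 0 <= a < 1 -> 0 < nu ->
  exists C r : R, [/\ 0 <= C, 0 <= r < 1 & forall X Y k,
    measurable_fun setT X -> measurable_fun setT Y ->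
    rint P (fun w => `|X w| `^ (2 + nu)) ->
    rint P (fun w => `|Y w| `^ (2 + nu)) ->
    \int[P]_w (`|X w| `^ (2 + nu)) <= K ->
    \int[P]_w (`|Y w| `^ (2 + nu)) <= K ->
    (forall s t, `|tail_dependence X Y s t| <= a ^+ k) ->
    `|cov P X Y| <= C * r ^+ k].
Proof.
move=> /andP[a0 a1] nu0.
(* Since [a] may be 0, it is raised to a positive base whose powers can be inverted. *)
pose a' : R := Num.max a 2^-1.
have a'0 : 0 < a' by rewrite lt_max; apply/orP; right; lra.
have a'1 : a' < 1 by rewrite gt_max a1/=; lra.
(* A fourth root, so that a squared height of order [b ^ (- 2 k)] times [a' ^ k] is still
   [b ^ (2 k)]. *)
pose b := Num.sqrt (Num.sqrt a').
have b0 : 0 < b by rewrite !sqrtr_gt0.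
have b4 : b ^+ 4 = a'.
  by rewrite (exprM b 2 2) sqr_sqrtr ?sqrtr_ge0// sqr_sqrtr// ltW.
have b1 : b < 1.
  by rewrite ltNge; apply/negP => h; move: a'1; rewrite ltNge -b4 exprn_ege1.
(* Chosen so that the squared mesh [c ^ (2 k)] equals [b ^ (k nu)], the size of the truncation
   factor. *)
pose c := Num.sqrt (b `^ nu).
have c2 : c ^+ 2 = b `^ nu by rewrite sqr_sqrtr ?powR_ge0.
have c0 : 0 < c by rewrite sqrtr_gt0 powR_gt0.
have c1 : c < 1.
  rewrite ltNge; apply/negP => h; have : 1 <= c ^+ 2 by rewrite exprn_ege1.
  rewrite c2 leNgt => /negP; apply; have <- : 1 `^ nu = 1 :> R by rewrite powR1.
  by apply: gt0_ltr_powR; rewrite ?nnegrE ?ltW.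
(* No sign of [K] is assumed, yet [C] has to be nonnegative. *)
pose K' := Num.max K 0.
have K'0 : 0 <= K' by rewrite le_max lexx orbT.
exists (16 + 7 * (1 + K')), (Num.max (b ^+ 2) c); split.
- lra.
- by rewrite le_max (ltW c0) orbT/= gt_max c1 andbT expr_lt1// ltW.
move=> X Y k mX mY iX iY XK YK dep.
have {}XK : \int[P]_w (`|X w| `^ (2 + nu)) <= K' by rewrite le_max XK.
have {}YK : \int[P]_w (`|Y w| `^ (2 + nu)) <= K' by rewrite le_max YK.
(* Truncating at height [t], about [b ^- k], with mesh [c ^+ k], makes both the
   mixing term [t ^+ 2 * a ^+ k] and the truncation error geometric. *)
set B := b ^+ k; set h := c ^+ k.
have B0 : 0 < B by rewrite exprn_gt0.
have h0 : 0 < h by rewrite exprn_gt0.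
have B1 : B <= 1 by rewrite exprn_ile1// ltW.
have h1 : h <= 1 by rewrite exprn_ile1// ltW.
have Bi1 : 1 <= B^-1 by rewrite invf_ge1.
(* Rounding up costs at most one mesh, and [h <= 1 <= B^-1]; hence the height lies between [B^-1]
   and [2 * B^-1]. *)
pose N := (Num.truncn (B^-1 / h)).+1.
have N0 : (0 < N)%N by [].
set t := N%:R * h.
have Bh0 : 0 <= B^-1 / h by rewrite divr_ge0 ?ltW// invr_gt0.
have /andP[tl tu] := truncn_itv Bh0.
have t1 : B^-1 <= t by rewrite -ler_pdivrMr// ltW.
have t2 : t <= 2 * B^-1.
  rewrite /t /N -(natr1 (Num.truncn _)) mulrDl mul1r.
  rewrite ler_pdivlMr// in tl; rewrite (mulrDl 1 1) !mul1r lerD//.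
  exact: le_trans Bi1.
have t0 : 0 < t by rewrite (lt_le_trans _ t1)// invr_gt0.
have tnu : (t `^ nu)^-1 <= h ^+ 2.
  have -> : h ^+ 2 = ((B^-1) `^ nu)^-1.
    have Bnu : B `^ nu = h ^+ 2.
      rewrite -exprM mulnC exprM c2 -powR_mulrn ?powR_ge0// -powRrM mulrC powRrM.
      by rewrite powR_mulrn ?ltW.
    have n0 : (B^-1) `^ nu != 0 by rewrite gt_eqF// powR_gt0 ?invr_gt0.
    apply: (mulIf n0); rewrite mulVf// -Bnu -powRM ?invr_ge0 ?ltW//.
    by rewrite mulfV ?gt_eqF// powR1.
  rewrite lef_pV2 ?posrE ?powR_gt0 ?invr_gt0//.
  by apply: (ge0_ler_powR _ _ _ t1); rewrite ?nnegrE ?invr_ge0; exact: ltW.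
have [sX' X'] := mean_sqr_stair h0 N0 nu0 mX iX XK.
have [sY' Y'] := mean_sqr_stair h0 N0 nu0 mY iY YK.
have [sX X2] := mean_sqr_moment nu0 mX iX XK.
have [sY Y2] := mean_sqr_moment nu0 mY iY YK.
have hK : h ^+ 2 + (t `^ nu)^-1 * K' <= h ^+ 2 * (1 + K').
  by rewrite mulrDr mulr1 lerD2l ler_wpM2r.
have {}X' := le_trans X' hK; have {}Y' := le_trans Y' hK.
have K1 : 0 <= 1 + K' by rewrite addr_ge0.
have hh : 0 < h <= 1 by rewrite h0.
apply: le_trans (mixing_cov_stair hh K1 sX sY X2 Y2 X' Y' dep) _.
set r := Num.max (b ^+ 2) c.
have hr : h <= r ^+ k.
  by apply: lerXn2r; rewrite ?nnegrE /r ?le_max ?lexx ?orbT ?(ltW c0) ?orbT.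
have Br : B ^+ 2 <= r ^+ k.
  rewrite -exprM mulnC exprM.
  by apply: lerXn2r; rewrite ?nnegrE /r ?le_max ?lexx ?exprn_ge0// ltW.
have l4 : (2 * (N%:R * h)) ^+ 2 * a ^+ k <= 16 * B ^+ 2.
  have ak : a ^+ k <= B ^+ 4.
    rewrite -exprM mulnC exprM b4.
    by apply: lerXn2r; rewrite ?nnegrE ?(ltW a'0)// le_max lexx.
  have tt : (2 * t) ^+ 2 <= (4 * B^-1) ^+ 2.
    have -> : 4 * B^-1 = 2 * (2 * B^-1) by rewrite mulrA -natrM.
    by apply: lerXn2r; rewrite ?nnegrE ?ler_pM2l// ltW// !mulr_gt0// invr_gt0.
  apply: (le_trans (ler_pM _ _ tt ak)); rewrite ?sqr_ge0 ?exprn_ge0//.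
  by rewrite le_eqVlt; apply/orP; left; apply/eqP; field; rewrite gt_eqF.
rewrite (mulrDl 16); apply: lerD.
  by apply: (le_trans l4); rewrite ler_pM2l.
by rewrite -mulrA ler_pM2l// mulrC ler_wpM2l.
Qed.

End mixing_covariance.

(** * Evaluations of random elements of C([0,1]) *)

Section C01_measurability.
Context {R : realType}.
Implicit Types (f : C01 R) (t : unit_itv R).

(** Typed into [R^o] to be one of the linear functionals over which [is_expectation] quantifies. *)
Definition evalC t : C01 R -> R^o := fun f => f t.

Lemma evalC_linear t : linear (evalC t).
Proof. by []. Qed.

HB.instance Definition _ t :=
  GRing.isLinear.Build R (C01 R) R^o _ (evalC t) (evalC_linear t).

Lemma normC_ge f t : `|f t| <= `|f|.
Proof. exact: supnorm_ub. Qed.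

Lemma evalC_continuous t : continuous (evalC t).
Proof.
move=> f; apply/(@cvgrPdist_le _ _ _ _ (nbhs_filter f)) => e e0.
apply/nbhs_ballP; exists e => //= g.
rewrite -ball_normE /= => fg; apply: le_trans (ltW fg).
exact: (normC_ge (f - g) t).
Qed.

Lemma continuousC_measurable (g : C01 R -> R) :
  continuous g -> measurable_fun setT g.
Proof.
move=> cg; apply: (measurability _ (RGenOInfty.measurableE R)) => //.
move=> _ [_ [a ->] <-]; rewrite setTI; apply: sub_sigma_algebra.
by apply: open_comp => // x _; exact: cg.
Qed.

Lemma evalC_measurable t : measurable_fun setT (fun f : C01 R => f t).
Proof. by apply: continuousC_measurable; exact: (@evalC_continuous t). Qed.

Lemma normC_measurable : measurable_fun setT (fun f : C01 R => `|f|).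
Proof. apply: continuousC_measurable; exact: (@norm_continuous _ (C01 R)). Qed.

(** A continuous retraction of the line onto [[0, 1]]: it transports the density of the rationals to
    the domain of the paths. *)
Let clip (x : R) : R := Num.max 0 (Num.min 1 x).

Let clip_in x : clip x \in `[0, 1]%classic.
Proof.
by rewrite inE/= in_itv/= /clip le_max lexx/= ge_max ler01/= ge_min lexx.
Qed.

Let clipI x : unit_itv R := exist _ (clip x) (clip_in x).

Let clipI_val t : clipI (set_val t) = t.
Proof.
apply: val_inj => /=; have := set_valP t; rewrite /= in_itv/= => /andP[h0 h1].
by rewrite /clip min_r// max_r.
Qed.

Let clipI_continuous : continuous clipI.
Proof.
apply: continuous_comp_initial => x.
apply: (@continuous_max R R (cst 0) (fun x => Num.min 1 x)).
  exact: cst_continuous.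
apply: (@continuous_min R R (cst 1) id); first exact: cst_continuous.
exact: cvg_id.
Qed.

Let normC_gt_rat f (a : R) : 0 <= a ->
  a < `|f| <-> exists q : rat, a < `|f (clipI (ratr q))|.
Proof.
move=> a0; split => [af|[q /lt_le_trans]]; last by apply; exact: normC_ge.
have [t aft] : exists t, a < `|f t|.
  apply: contrapT => /forallNP h; move: af; rewrite ltNge => /negP; apply.
  by apply: supnorm_le => t; rewrite leNgt; exact/negP.
have cg : continuous (fun x => `|f (clipI x)|).
  move=> x.
  apply: (@continuous_comp _ _ _ (fun x => f (clipI x)) (fun y : R => `|y|)).
    apply: (@continuous_comp _ _ _ clipI f); first exact: clipI_continuous.
    exact: C01_continuous.
  exact: norm_continuous.
have oA : open [set x | a < `|f (clipI x)|].
  rewrite (_ : [set x | _] = (fun x => `|f (clipI x)|) @^-1` [set y | a < y])//.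
  by apply: open_comp; [move=> x _; exact: cg|exact: open_gt].
have A0 : [set x | a < `|f (clipI x)|] !=set0.
  by exists (set_val t); rewrite /= clipI_val.
by have [x [/= h [q _ qx]]] := @dense_rat R _ A0 oA; exists q; rewrite qx.
Qed.

(** By continuity of the paths the norm is a supremum over the countably many clipped rationals.
    Measurability at each point, which sums inherit from real variables, is therefore enough. *)
Lemma measurable_normC (d : measure_display) (T : measurableType d)
    (U : T -> C01 R) :
  (forall t, measurable_fun setT (fun w => U w t)) ->
  measurable_fun setT (fun w => `|U w|).
Proof.
move=> mU; apply: (measurability _ (RGenOInfty.measurableE R)) => //.
move=> _ [_ [a ->] <-]; rewrite setTI.
have [a0|a0] := ltP a 0.
  rewrite (_ : _ @^-1` _ = setT)//; apply/seteqP; split => // w _ /=.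
  by rewrite in_itv/= andbT (lt_le_trans a0).
rewrite (_ : _ @^-1` _ =
    \bigcup_(q : rat) [set w | a < `|U w (clipI (ratr q))|]).
  apply: bigcupT_measurable_rat => q; rewrite -[X in measurable X]setTI.
  rewrite (_ : [set w | _] =
      (fun w => `|U w (clipI (ratr q))|) @^-1` `]a, +oo[); last first.
    by apply/seteqP; split => w /=; rewrite in_itv/= andbT.
  by apply: measurableT_comp => //; exact: mU.
apply/seteqP; split => w /=; rewrite in_itv/= andbT.
  by move=> /(normC_gt_rat _ a0)[q h]; exists q.
by move=> [q _ h]; apply/(normC_gt_rat _ a0); exists q.
Qed.

Lemma sumCE (I : Type) (s : seq I) (F : I -> C01 R) t :
  (\sum_(i <- s) F i) t = \sum_(i <- s) F i t.
Proof. exact: (raddf_sum (evalC t)). Qed.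

End C01_measurability.

(** * Mixing, means and moments of the array at a fixed point *)

Section array_evaluations.
Context {R : realType} {d : measure_display} {T : measurableType d}.
Variable P : probability T R.
Variable X : nat -> nat -> {RV P >-> C01 R}.
Implicit Types (t : unit_itv R) (n j k : nat).

Lemma measurable_eval n j t : measurable_fun setT (fun w => X n j w t).
Proof.
by apply: (@measurableT_comp _ _ _ _ _ _ (fun f : C01 R => f t));
  [exact: evalC_measurable|exact: measurable_funP].
Qed.

Lemma row_field_ge n j k k' t (s : R) : (k <= j <= k')%N ->
  row_field X n k k' [set w | s <= X n j w t].
Proof.
move=> jk; apply: sub_sigma_algebra; exists j => //.
exists [set f : C01 R | s <= f t]; last by rewrite setTI.
exact: measurable_ge (evalC_measurable t).
Qed.

(** The difference is [P(F)] times [P(G|F) - P(G)], and [P(F) <= 1]. A null [F] does not enter the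
    supremum, but then both terms vanish. *)
Lemma phi_mix_le (F G : set T) calF calG (a : R) :
  measurable F -> measurable G -> calF F -> calG G -> 0 <= a ->
  (phi_mix P calF calG <= a%:E)%E ->
  `|fine (P (F `&` G)) - fine (P F) * fine (P G)| <= a.
Proof.
move=> mF mG cF cG a0 phia.
have fF := fin_num_measure P F mF.
have PF0 : 0 <= fine (P F) by rewrite fine_ge0.
have PF1 : fine (P F) <= 1 by rewrite -lee_fin fineK// probability_le1.
have [PF|PF] := ltP 0%E (P F); last first.
  have PF00 : P F = 0%E by apply/eqP; rewrite eq_le PF measure_ge0.
  have -> : P (F `&` G) = 0%E.
    apply/eqP; rewrite eq_le measure_ge0 andbT -PF00.
    by apply: le_measure; rewrite ?inE//; exact: measurableI.
  by rewrite PF00/= mul0r subrr normr0.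
have PFp : 0 < fine (P F) by rewrite fine_gt0// PF/= ltey_eq fF.
have h : (`|cond_prob P G F - fine (P G)|%:E <= a%:E)%E.
  by apply: le_trans phia; apply: ereal_sup_ubound; exists F, G.
rewrite lee_fin in h.
have -> : fine (P (F `&` G)) - fine (P F) * fine (P G) =
    fine (P F) * (cond_prob P G F - fine (P G)).
  by rewrite /cond_prob (setIC G) mulrBr mulrCA mulfV ?mulr1// gt_eqF.
rewrite normrM ger0_norm//; apply: (@le_trans _ _ (1 * a)); last by rewrite mul1r.
exact: ler_pM.
Qed.

Lemma tail_dependence_le (a : R) n i j t (s s' : R) :
  0 <= a -> (forall k, (1 <= k)%N -> (mix_coef P X k <= (a ^+ k)%:E)%E) ->
  (1 <= i)%N -> (i < j <= n)%N ->
  `|tail_dependence P (fun w => X n i w t) (fun w => X n j w t) s s'|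
    <= a ^+ (j - i).
Proof.
move=> a0 mix i1 /andP[ij jn].
have k1 : (1 <= j - i)%N by rewrite subn_gt0.
(* The past ends at [k' = i] and the future starts at [j], written as [k' + k] with lag [k = j - i]
   to match [mix_coef]. *)
apply: (@phi_mix_le _ _ (row_field X n 1 i) (row_field X n (i + (j - i)) n)).
- exact/measurable_ge/measurable_eval.
- exact/measurable_ge/measurable_eval.
- by apply: row_field_ge; rewrite i1 leqnn.
- by apply: row_field_ge; rewrite subnKC ?jn ?leqnn// ltnW.
- by rewrite exprn_ge0.
apply: le_trans (mix _ k1); apply: (@le_trans _ _
  (\big[maxe/-oo]_(1 <= k' < (n - (j - i)).+1)
     phi_mix P (row_field X n 1 k') (row_field X n (k' + (j - i)) n))%E).
  apply: (@le_bigmax_seq _ _ _ _ _ i) => //.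
  by rewrite mem_index_iota i1/=; lia.
by apply: ereal_sup_ubound; exists n => //; lia.
Qed.

Lemma eval_mean n j t (m : C01 R) : is_expectation P (X n j) m ->
  \int[P]_w (X n j w t) = m t.
Proof.
move=> /(_ (evalC t) (@evalC_continuous R t))[_].
by rewrite unlock /evalC /= /Rintegral => ->.
Qed.

Lemma eval_moment n j t (K nu : R) : 0 <= nu ->
  ('E_P[fun w => (`|X n j w| `^ (2 + nu))%R] <= K%:E)%E ->
  rint P (fun w => `|X n j w t| `^ (2 + nu)) /\
  \int[P]_w (`|X n j w t| `^ (2 + nu)) <= K.
Proof.
move=> nu0 EK.
have mN : measurable_fun setT (fun w => `|X n j w| `^ (2 + nu)).
  apply: (@measurableT_comp _ _ _ _ _ _ (@powR R ^~ (2 + nu))).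
    exact: measurable_powR.
  apply: (@measurableT_comp _ _ _ _ _ _ (fun f : C01 R => `|f|)).
    exact: normC_measurable.
  exact: measurable_funP.
have iN : rint P (fun w => `|X n j w| `^ (2 + nu)).
  apply/integrableP; split; first exact/measurable_EFinP.
  apply: le_lt_trans (ltry K); apply: le_trans EK; rewrite unlock.
  by under eq_integral do rewrite /= ger0_norm ?powR_ge0//.
have mE : measurable_fun setT (fun w => `|X n j w t| `^ (2 + nu)).
  apply: (@measurableT_comp _ _ _ _ _ _ (@powR R ^~ (2 + nu))).
    exact: measurable_powR.
  apply: (@measurableT_comp _ _ _ _ _ _ (fun y : R => `|y|)) => //.
  exact: measurable_eval.
have le w : `|X n j w t| `^ (2 + nu) <= `|X n j w| `^ (2 + nu).
  apply: ge0_ler_powR; rewrite ?nnegrE ?addr_ge0//.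
  exact: normC_ge.
have iE : rint P (fun w => `|X n j w t| `^ (2 + nu)).
  by apply: rint_le mE iN _ => w; rewrite ger0_norm ?powR_ge0.
split => //; apply: (@le_trans _ _ (\int[P]_w (`|X n j w| `^ (2 + nu)))).
  exact: mean_le.
rewrite -lee_fin; apply: le_trans EK; rewrite unlock /Rintegral fineK//.
exact: integrable_fin_num.
Qed.

End array_evaluations.

(** * Location of the maximizer *)

Section argmax.
Context {R : realType}.
Implicit Types f : nat -> R.

Lemma seq_argmax f (s : seq nat) : s != [::] ->
  exists2 k, k \in s & all (fun i => f i <= f k) s.
Proof.
elim: s => // a s IH _; case: (eqVneq s [::]) => [->|/IH[k ks /allP kmax]].
  by exists a; rewrite ?inE//= lexx.
have [ak|ka] := leP (f a) (f k).
  by exists k; rewrite ?inE ?ks ?orbT//= ak; exact/allP.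
exists a; rewrite ?inE ?eqxx//= lexx/=; apply/allP => i /kmax ik.
exact: le_trans (ltW ka).
Qed.

Lemma bigmin_mem (s : seq nat) n : s != [::] -> all (leq^~ n) s ->
  \big[minn/n]_(k <- s) k \in s.
Proof.
elim: s => // a s IH _ /= /andP[an sn]; rewrite big_cons inE.
have [->|s0] := eqVneq s [::].
  by rewrite big_nil (minn_idPl an) eqxx.
by rewrite minnE -minnE /minn; case: ifP; rewrite ?eqxx// IH ?orbT.
Qed.

(** For [1 < n] the index range is nonempty, so a maximizer exists and the default [n], larger than
    every index, is never returned. *)
Lemma bigmin_argmax n f : (1 < n)%N ->
  let k := \big[minn/n]_(k <- argmax_idx n f) k in
  (1 <= k < n)%N /\ (forall i, (1 <= i < n)%N -> f i <= f k).
Proof.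
move=> n1 k; have : k \in argmax_idx n f.
  apply: bigmin_mem.
    have [|m ms mmax] := @seq_argmax f (index_iota 1 n).
      by rewrite -size_eq0 size_iota subn_eq0 -ltnNge.
    have : m \in argmax_idx n f by rewrite mem_filter mmax.
    by case: argmax_idx.
  apply/allP => i; rewrite mem_filter mem_index_iota => /andP[_ /andP[_]].
  exact: ltnW.
rewrite mem_filter mem_index_iota => /andP[/allP kmax k1]; split => // i i1.
by apply: kmax; rewrite mem_index_iota.
Qed.

End argmax.

(** * Deterministic localization of the maximizer *)

Section change_point.
Context {R : realType}.
Implicit Types (D W V : C01 R).

(* Where [D] is large the drop [hK - h] of the signal beats the change of the
   noise; where [D] is small the signal stays far below [hK * |D|]. *)
Lemma tent_norm_lt D W V (h hK e eta : R) : 0 <= h <= hK ->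
  `|W| <= 3 * e -> `|V| <= 3 * e -> `|W - V| <= eta ->
  eta < (hK - h) * `|D| / 2 -> 12 * e < hK * `|D| ->
  `|h *: D + W| < `|hK *: D + V|.
Proof.
move=> /andP[h0 hhK] We Ve WVeta etad ed; set dn := `|D|.
have d0 : 0 <= dn by exact: normr_ge0.
have hK0 : 0 <= hK by exact: le_trans hhK.
have UK : hK * dn - 3 * e <= `|hK *: D + V|.
  have := ler_normB (hK *: D + V) V; rewrite addrK normrZ ger0_norm// -/dn.
  lra.
(* Strict inequalities at each point do not survive a supremum, so a margin uniform in [t] is fixed
   first: one candidate for each of the two regimes of [D]. *)
pose kap := Num.min ((hK - h) * dn / 2 - eta) (hK * dn / 2 - 6 * e).
have kap0 : 0 < kap by rewrite lt_min; apply/andP; split; rewrite /dn; lra.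
have kap1 : kap <= (hK - h) * dn / 2 - eta by rewrite ge_min lexx.
have kap2 : kap <= hK * dn / 2 - 6 * e by rewrite ge_min lexx orbT.
suff : `|h *: D + W| <= `|hK *: D + V| - kap by lra.
apply: supnorm_le => t; rewrite C01_DE C01_ZE.
have Wt : `|W t| <= 3 * e by apply: le_trans We; exact: normC_ge.
have WVt : `|W t - V t| <= eta.
  by apply: le_trans WVeta; exact: (normC_ge (W - V) t).
have Ut : `|hK * D t + V t| <= `|hK *: D + V|.
  exact: (normC_ge (hK *: D + V) t).
move: Wt WVt Ut; rewrite !ler_norml => /andP[w1 w2] /andP[v1 v2] /andP[u1 u2].
have e0 : 0 <= e by lra.
have Hdn : h * dn <= hK * dn by rewrite ler_wpM2r.
have hd0 : 0 <= h * dn by rewrite mulr_ge0.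
have [Dt|Dt] := leP (dn / 2) (D t).
  have m1 : 0 <= h * (D t - dn / 2) by rewrite mulr_ge0// subr_ge0.
  have m2 : 0 <= (hK - h) * (D t - dn / 2) by rewrite mulr_ge0// subr_ge0.
  by apply/andP; split; lra.
have [Dt'|Dt'] := leP (D t) (- (dn / 2)).
  have m1 : 0 <= h * (- D t - dn / 2) by rewrite mulr_ge0//; lra.
  have m2 : 0 <= (hK - h) * (- D t - dn / 2) by rewrite mulr_ge0//; lra.
  by apply/andP; split; lra.
have m1 : 0 <= h * (dn / 2 - D t) by rewrite mulr_ge0//; lra.
have m2 : 0 <= h * (dn / 2 + D t) by rewrite mulr_ge0//; lra.
by apply/andP; split; lra.
Qed.

Lemma sum_cp_mean (a b : R) K k :
  \sum_(1 <= j < k.+1) (if (j <= K)%N then a else b) =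
  (minn k K)%:R * a + (k - K)%:R * b.
Proof.
elim: k => [|k IH]; first by rewrite big_geq// min0n sub0n !mul0r addr0.
rewrite big_nat_recr//= IH; case: (ltnP k K) => kK.
  have -> : minn k.+1 K = k.+1 by apply/minn_idPl.
  have -> : (k - K = 0)%N by lia.
  have -> : (k.+1 - K = 0)%N by lia.
  by rewrite -natr1; ring.
have -> : minn k.+1 K = K by apply/minn_idPr; lia.
by rewrite subSn// -(natr1 (k - K)); ring.
Qed.

(** With truncated subtraction one of the two differences is 0, so the sum is [|k - l|]; this
    encoding of the distance is used from here on. *)
Lemma truncated_dist_lt (k l m : nat) : (k - l + (l - k) < m)%N ->
  (k <= l + m)%N /\ (l <= k + m)%N.
Proof. by split; lia. Qed.

(** The signal [h(k)] of the overview; [bridge] below is its noise [W(k)], the tied-down partial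
    sums. *)
Definition tent n K k : R :=
  if (k <= K)%N then k%:R / n%:R * (1 - K%:R / n%:R)
  else K%:R / n%:R * (1 - k%:R / n%:R).

Definition bridge (Z : nat -> C01 R) n k : C01 R :=
  n%:R^-1 *: (\sum_(1 <= j < k.+1) Z j
    - (k%:R / n%:R) *: \sum_(1 <= j < n.+1) Z j).

Lemma Uhat_decomposition (d : measure_display) (Omega : measurableType d)
    (X : nat -> nat -> Omega -> C01 R)
    (s : R) (mu1 mu2 : C01 R) n k w :
  let K := Num.truncn (n%:R * s) in
  (0 < n)%N -> (K <= n)%N -> (k <= n)%N ->
  Uhat X n (k%:R / n%:R) w = tent n K k *: (mu1 - mu2) +
    bridge (fun j => centered X (cp_mean s mu1 mu2) n j w) n k.
Proof.
move=> K n0 Kn kn; have nR : n%:R != 0 :> R by rewrite pnatr_eq0 -lt0n.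
(* At [s = k / n] the integer part is exactly [k], so the interpolation term drops out. *)
have km : Num.truncn (k%:R / n%:R * n%:R : R) = k by rewrite divfK// natrK.
apply: C01P => t.
rewrite /Uhat km C01_ZE !C01_DE C01_NE !C01_ZE !sumCE subrr mulr0 mul0r addr0.
rewrite !C01_DE !C01_NE !C01_ZE !sumCE.
have e m : \sum_(1 <= j < m.+1) centered X (cp_mean s mu1 mu2) n j w t =
    \sum_(1 <= j < m.+1) X n j w t -
    ((minn m K)%:R * mu1 t + (m - K)%:R * mu2 t).
  rewrite -sum_cp_mean -sumrB; apply: eq_bigr => j _.
  by rewrite /centered C01_DE C01_NE /cp_mean -/K; case: ifP.
rewrite !e /tent (minn_idPr Kn) (natrB _ Kn).
case: leqP => kK.
  rewrite (_ : (k - K)%N = 0%N); last by lia.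
  by field.
rewrite (natrB _ (ltnW kK)).
by field.
Qed.

(** Taking [m = K] and [m = n - K] bounds the partial sums [S K] and [S n] by [e K] and [e n]. Then
    [S k] is at most [2 e n] and its centering at most [e n], whence 3. In the difference,
    [S k - S K] and [(k - K) / n] times [S n] each cost [e |k - K|]. *)
Lemma bridge_le (Z : nat -> C01 R) n K C0 (e : R) : (0 < n)%N -> (K <= n)%N ->
  0 <= e -> (C0 <= K)%N -> (C0 <= n - K)%N ->
  (forall m, (C0 <= m <= K)%N -> `|\sum_(i < m) Z (K - i)%N| <= e * m%:R) ->
  (forall m, (C0 <= m <= n - K)%N ->
     `|\sum_(i < m) Z (K.+1 + i)%N| <= e * m%:R) ->
  `|bridge Z n K| <= 3 * e /\
  forall k, (k <= n)%N -> (C0 <= k - K + (K - k))%N ->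
    `|bridge Z n k| <= 3 * e /\
    `|bridge Z n k - bridge Z n K| <=
      2 * e * ((k - K + (K - k))%N%:R / n%:R).
Proof.
move=> n0 Kn e0 C0K C0nK left right.
pose S k := \sum_(1 <= j < k.+1) Z j.
have Sl k : (k <= K)%N -> S K - S k = \sum_(i < K - k) Z (K - i)%N.
  move=> kK; rewrite /S (big_cat_nat _ (n := k.+1))//= addrAC subrr add0r.
  rewrite big_nat_rev/= -{1}[k.+1]add0n big_addn subSS big_mkord.
  by apply: eq_bigr => i _; congr Z; have := ltn_ord i; lia.
have Sr k : (K <= k)%N -> S k - S K = \sum_(i < k - K) Z (K.+1 + i)%N.
  move=> kK; rewrite /S (big_cat_nat _ (n := K.+1))//= addrAC subrr add0r.
  rewrite -{1}[K.+1]add0n big_addn subSS big_mkord.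
  by apply: eq_bigr => i _; rewrite addnC.
have nR : 0 < n%:R :> R by rewrite ltr0n.
have SK : `|S K| <= e * K%:R.
  have := left K; rewrite C0K leqnn => /(_ isT).
  by have := Sl 0%N (leq0n _); rewrite {2}/S big_geq// subr0 subn0 => ->.
have Sn : `|S n| <= e * n%:R.
  have h := right (n - K)%N; rewrite C0nK leqnn -Sr// in h.
  rewrite -(subrK (S K) (S n)) (le_trans (ler_normD _ _))//.
  by have := h isT; rewrite natrB//; lra.
have Sk k : (k <= n)%N -> (C0 <= k - K + (K - k))%N ->
    `|S k - S K| <= e * (k - K + (K - k))%N%:R.
  move=> kn; case: (leqP K k) => kK h.
    have eK : (K - k = 0)%N by lia.
    by rewrite eK addn0 in h *; rewrite Sr// right//; lia.
  have eK : (k - K = 0)%N by lia.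
  by rewrite eK add0n in h *; rewrite distrC Sl ?left// ?(ltnW kK)//; lia.
have nW (k : nat) x : `|S k| <= x -> (k <= n)%N ->
    `|bridge Z n k| <= (x + e * n%:R) / n%:R.
  move=> Skx kn; rewrite /bridge normrZ gtr0_norm ?invr_gt0// mulrC.
  rewrite ler_pM2r ?invr_gt0// (le_trans (ler_normB _ _))// lerD//.
  rewrite normrZ ger0_norm ?divr_ge0//.
  rewrite (le_trans _ Sn)// ler_piMl// ler_pdivrMr// mul1r ler_nat//.
split.
  apply: le_trans (nW _ _ SK Kn) _; rewrite ler_pdivrMr//.
  have : e * K%:R <= e * n%:R by rewrite ler_wpM2l// ler_nat.
  have : 0 <= e * n%:R by rewrite mulr_ge0.
  lra.
move=> k kn C0k; have Skk := Sk k kn C0k.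
have pn : e * (k - K + (K - k))%N%:R <= e * n%:R.
  by rewrite ler_wpM2l// ler_nat; lia.
have Kn' : e * K%:R <= e * n%:R by rewrite ler_wpM2l// ler_nat.
split.
  have Sk2 : `|S k| <= 2 * (e * n%:R).
    rewrite -(subrK (S K) (S k)) (le_trans (ler_normD _ _))//; lra.
  apply: le_trans (nW _ _ Sk2 kn) _; rewrite ler_pdivrMr//; lra.
have -> : bridge Z n k - bridge Z n K =
    n%:R^-1 *: ((S k - S K) - ((k%:R - K%:R) / n%:R) *: S n).
  rewrite /bridge -/(S k) -/(S K) -/(S n); apply: C01P => t.
  by rewrite !(C01_DE, C01_NE, C01_ZE); ring.
rewrite normrZ gtr0_norm ?invr_gt0// mulrA mulrC ler_pM2r ?invr_gt0//.
rewrite (le_trans (ler_normB _ _))// normrZ normf_div (gtr0_norm nR).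
have -> : `|k%:R - K%:R : R| = (k - K + (K - k))%N%:R.
  case: (leqP K k) => kK.
    have -> : (K - k = 0)%N by lia.
    by rewrite addn0 -natrB// ger0_norm.
  have -> : (k - K = 0)%N by lia.
  by rewrite add0n distrC -natrB ?(ltnW kK)// ger0_norm.
set p : R := (_ + _)%N%:R in Skk *.
have p0 : 0 <= p by [].
have : p / n%:R * `|S n| <= p * e.
  by rewrite -mulrA ler_wpM2l// mulrC ler_pdivrMr.
lra.
Qed.

(** Per unit of [k / n] the tent rises with slope [1 - K / n] and falls with slope [K / n], both at
    least [c]. *)
Lemma tent_drop n K k (c : R) : (0 < n)%N -> (K <= n)%N -> (k <= n)%N ->
  0 <= c -> c <= K%:R / n%:R -> c <= 1 - K%:R / n%:R ->
  0 <= tent n K k /\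
  c * ((k - K + (K - k))%N%:R / n%:R) <= tent n K K - tent n K k.
Proof.
move=> n0 Kn kn c0 c1 c2; have nR : 0 < n%:R :> R by rewrite ltr0n.
have kn1 : k%:R / n%:R <= 1 :> R by rewrite ler_pdivrMr// mul1r ler_nat.
have kn0 : 0 <= k%:R / n%:R :> R by rewrite divr_ge0.
rewrite /tent leqnn; case: leqP => kK.
  split; first by rewrite mulr_ge0//; lra.
  have -> : (k - K = 0)%N by lia.
  have kK' : k%:R / n%:R <= K%:R / n%:R :> R by rewrite ler_pM2r ?invr_gt0 ?ler_nat.
  rewrite add0n natrB// -subr_ge0.
  have -> : K%:R / n%:R * (1 - K%:R / n%:R) - k%:R / n%:R * (1 - K%:R / n%:R) -
     c * ((K%:R - k%:R) / n%:R) =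
     (1 - K%:R / n%:R - c) * (K%:R / n%:R - k%:R / n%:R) :> R by ring.
  by rewrite mulr_ge0// subr_ge0.
split; first by rewrite mulr_ge0//; lra.
have -> : (K - k = 0)%N by lia.
have kK' : K%:R / n%:R <= k%:R / n%:R :> R.
  by rewrite ler_pM2r ?invr_gt0 ?ler_nat// ltnW.
rewrite addn0 natrB ?(ltnW kK)// -subr_ge0.
have -> : K%:R / n%:R * (1 - K%:R / n%:R) - K%:R / n%:R * (1 - k%:R / n%:R) -
   c * ((k%:R - K%:R) / n%:R) =
   (K%:R / n%:R - c) * (k%:R / n%:R - K%:R / n%:R) :> R by ring.
by rewrite mulr_ge0// subr_ge0.
Qed.

(** The factor 2 in the hypotheses on [c] absorbs the rounding of [n s], at most one unit and hence
    at most [n c]. *)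
Lemma change_point_index (s c : R) n C0 :
  0 < c -> 2 * c <= s -> 2 * c <= 1 - s -> C0%:R + 2 <= n%:R * c ->
  let K := Num.truncn (n%:R * s) in
  [/\ c <= K%:R / n%:R, c <= 1 - K%:R / n%:R, (C0 < K)%N & (K + C0.+2 <= n)%N].
Proof.
move=> c0 cs cs' ncC K; have C00 : 0 <= C0%:R :> R by [].
have ns0 : 0 <= n%:R * s by rewrite mulr_ge0//; lra.
have /andP[] := truncn_itv ns0; rewrite -/K -(natr1 K).
move: K => K K1 K2.
have m1 : n%:R * (2 * c) <= n%:R * s by rewrite ler_wpM2l.
have m2 : n%:R * (2 * c) <= n%:R * (1 - s) by rewrite ler_wpM2l.
have nR : 0 < n%:R :> R by rewrite -(pmulr_lgt0 _ c0); lra.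
split.
- by rewrite ler_pdivlMr//; lra.
- by rewrite lerBrDr addrC -lerBrDr ler_pdivrMr//; lra.
- by rewrite -(ltr_nat R); lra.
- by rewrite -(ler_nat R) natrD -(natr1 C0.+1) -(natr1 C0); lra.
Qed.

(** The 24 meets both requirements of [tent_norm_lt]: [12 e] is half of [c ^ 2 |mu1 - mu2|], while
    the peak is at least [c ^ 2]; and [2 e] lies below half of [c |mu1 - mu2|] because [c < 1]. An
    index at distance [C0] or more would thus lose to [K]. The extra unit in [C0.+1] is the rounding
    of [n s] to [K]. *)
Lemma s_tilde_close (d : measure_display) (Omega : measurableType d)
    (X : nat -> nat -> Omega -> C01 R)
    (s c : R) (mu1 mu2 : C01 R) n K C0 w :
  let Z j := centered X (cp_mean s mu1 mu2) n j w in
  let e := c ^+ 2 * `|mu1 - mu2| / 24 in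
  K = Num.truncn (n%:R * s) ->
  0 < `|mu1 - mu2| -> 0 <= s -> 0 < c ->
  c <= K%:R / n%:R -> c <= 1 - K%:R / n%:R ->
  (1 < n)%N -> (1 <= K < n)%N -> (1 <= C0)%N -> (C0 <= K)%N -> (C0 <= n - K)%N ->
  (forall m, (C0 <= m <= K)%N -> `|\sum_(i < m) Z (K - i)%N| <= e * m%:R) ->
  (forall m, (C0 <= m <= n - K)%N ->
     `|\sum_(i < m) Z (K.+1 + i)%N| <= e * m%:R) ->
  `|s_tilde X n w - s| <= C0.+1%:R / n%:R.
Proof.
move=> Z e KE d0 s0 c0 c1 c2 n1 /andP[K1 Kn] C0_gt0 C0K C0nK left right.
have n0 : (0 < n)%N by exact: ltnW.
have nR : 0 < n%:R :> R by rewrite ltr0n.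
have c1' : c < 1.
  have : K%:R / n%:R < 1 :> R by rewrite ltr_pdivrMr// mul1r ltr_nat.
  lra.
have e0 : 0 < e by rewrite /e divr_gt0// mulr_gt0// exprn_gt0.
have [VK Vk] := bridge_le n0 (ltnW Kn) (ltW e0) C0K C0nK left right.
pose f k := `|Uhat X n (k%:R / n%:R) w|.
have [k1 kmax] := bigmin_argmax f n1.
rewrite /s_tilde -/f.
set k := (\big[minn/n]_(_ <- _) _) in k1 kmax *.
have /andP[k0 kn] := k1.
have kK : (k - K + (K - k) < C0)%N.
  rewrite ltnNge; apply/negP => C0k.
  have := kmax K; rewrite K1 Kn => /(_ isT); rewrite leNgt => /negP; apply.
  have dec i : (i <= n)%N -> Uhat X n (i%:R / n%:R) w =
      tent n K i *: (mu1 - mu2) + bridge Z n i.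
    rewrite KE => ni; apply: Uhat_decomposition => //.
    by rewrite -KE ltnW.
  rewrite /f !dec ?(ltnW kn) ?(ltnW Kn)//.
  have [W1 W2] := Vk k (ltnW kn) C0k.
  have [h0 hd] := tent_drop n0 (ltnW Kn) (ltnW kn) (ltW c0) c1 c2.
  have p0 : 0 < (k - K + (K - k))%N%:R / n%:R :> R.
    by rewrite divr_gt0// ltr0n (leq_trans C0_gt0).
  have cp0 : 0 <= c * ((k - K + (K - k))%N%:R / n%:R) by rewrite mulr_ge0 ?ltW.
  apply: (tent_norm_lt _ W1 VK W2).
  - by apply/andP; split => //; lra.
  - have : c * ((k - K + (K - k))%N%:R / n%:R) * `|mu1 - mu2| <=
        (tent n K K - tent n K k) * `|mu1 - mu2| by rewrite ler_pM2r.
    move: p0 hd; set p : R := (k - K + (K - k))%N%:R / n%:R => p0 hd.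
    have : 0 < p * `|mu1 - mu2| * (c * (1 - c)).
      have c1c : 0 < 1 - c by rewrite subr_gt0.
      exact: mulr_gt0 (mulr_gt0 p0 d0) (mulr_gt0 c0 c1c).
    have := mulr_gt0 (mulr_gt0 c0 p0) d0.
    rewrite /e; lra.
  - have hc : c ^+ 2 <= tent n K K.
      by rewrite /tent leqnn expr2 ler_pM// ltW.
    have : c ^+ 2 * `|mu1 - mu2| <= tent n K K * `|mu1 - mu2|.
      by rewrite ler_pM2r.
    by move: e0; rewrite /e; lra.
have ns0 : 0 <= n%:R * s by rewrite mulr_ge0.
have /andP[t1 t2] := truncn_itv ns0; rewrite -KE in t1 t2.
rewrite ler_pdivlMr//.
have -> : `|k%:R / n%:R - s| * n%:R = `|k%:R - n%:R * s|.
  rewrite -[X in _ * X](gtr0_norm nR) -normrM mulrBl divfK ?gt_eqF//.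
  by rewrite (mulrC s).
have [kKC KkC] := truncated_dist_lt kK.
have kK1 : (k%:R : R) <= K%:R + C0%:R by rewrite -natrD ler_nat.
have kK2 : (K%:R : R) <= k%:R + C0%:R by rewrite -natrD ler_nat.
rewrite -(natr1 C0); rewrite -(natr1 K) in t2.
by rewrite ler_norml; apply/andP; split; lra.
Qed.

End change_point.

(** * The noise of a row *)

Section argmax_measurability.
Context {R : realType} {d : measure_display} {T : measurableType d}.

(** [Q] is arbitrary so that the induction can replace it by the set of [m] with [Q (minn a m)]
    whenever the head [a] is kept. *)
Lemma measurable_bigmin_filter (p : nat -> T -> bool) n s (Q : set nat) :
  (forall k, measurable [set w | p k w]) ->
  measurable [set w | Q (\big[minn/n]_(k <- [seq k <- s | p k w]) k)].
Proof.
move=> mp; elim: s Q => [|a s IH] Q.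
  have [Qn|Qn] := pselect (Q n).
    rewrite (_ : [set w | _] = setT)//; apply/seteqP; split => // w _ /=.
    by rewrite big_nil.
  rewrite (_ : [set w | _] = set0)//; apply/seteqP; split => // w /=.
  by rewrite big_nil.
pose g w := \big[minn/n]_(k <- [seq k <- s | p k w]) k.
rewrite (_ : [set w | _] =
    ([set w | p a w] `&` [set w | [set m | Q (minn a m)] (g w)]) `|`
    (~` [set w | p a w] `&` [set w | Q (g w)])).
  apply: measurableU; apply: measurableI.
  - exact: mp.
  - exact: (IH [set m | Q (minn a m)]).
  - exact/measurableC/mp.
  - exact: IH.
apply/seteqP; split => w /=; rewrite -/(g w); case: (p a w);
  rewrite ?big_cons -/(g w).
- by left.
- by right.
- by case=> -[].
- by case=> -[].
Qed.

Lemma measurable_argmax_idx (f : nat -> T -> R) n (Q : set nat) :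
  (forall k, measurable_fun setT (f k)) ->
  measurable [set w | Q (\big[minn/n]_(k <- argmax_idx n (f ^~ w)) k)].
Proof.
move=> mf; apply: measurable_bigmin_filter => k.
elim: (index_iota 1 n) => [|i s IH] /=.
  by rewrite (_ : [set w | _] = setT)//; apply/seteqP; split.
rewrite (_ : [set w | _] =
  [set w | f i w <= f k w] `&` [set w | all (fun i => f i w <= f k w) s]).
  apply: measurableI => //; rewrite -[X in measurable X]setTI.
  exact: (measurable_fun_ler (mf i) (mf k) measurableT (_ : measurable [set true])).
by apply/seteqP; split => w /= => [/andP[]|[-> ->]].
Qed.

Lemma measurable_Uhat (P : probability T R) (X : nat -> nat -> {RV P >-> C01 R})
    n s t : measurable_fun setT (fun w => Uhat X n s w t).
Proof.
have mS m : measurable_fun setT (fun w => (\sum_(1 <= j < m) X n j w) t).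
  under eq_fun do rewrite sumCE.
  by apply: measurable_sum => j; exact: measurable_eval.
rewrite (_ : (fun _ => _) = (fun w => n%:R^-1 *
   ((\sum_(1 <= j < (Num.truncn (s * n%:R)).+1) X n j w) t +
    (n%:R * (s - (Num.truncn (s * n%:R))%:R / n%:R)) *
      X n (Num.truncn (s * n%:R)).+1 w t -
    s * (\sum_(1 <= j < n.+1) X n j w) t)))//.
apply: measurable_funM => //; apply: measurable_funB.
  apply: measurable_funD => //; apply: measurable_funM => //.
  exact: measurable_eval.
by apply: measurable_funM.
Qed.

(** The estimator is a function of an integer index, so any [Q] will do, Borel or not. This makes
    the large-error event measurable, as monotonicity of [P] requires. *)
Lemma measurable_s_tilde (P : probability T R)
    (X : nat -> nat -> {RV P >-> C01 R}) n (Q : set R) :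
  measurable [set w | Q (s_tilde X n w)].
Proof.
pose f k w : R := `|Uhat X n (k%:R / n%:R) w|.
apply: (@measurable_argmax_idx f n [set m | Q (m%:R / n%:R)]) => k.
by apply: measurable_normC => t; exact: measurable_Uhat.
Qed.

End argmax_measurability.

(** * Covariances, energies and path regularity of the centered rows *)

Section noise.
Context {R : realType} {d : measure_display} {T : measurableType d}.
Variable P : probability T R.
Implicit Types (f g : T -> R).

Lemma mean_centered_mul f g : sqint P f -> sqint P g ->
  \int[P]_w ((f w - \int[P]_v f v) * (g w - \int[P]_v g v)) = cov P f g.
Proof.
move=> sf sg; set a := \int[P]_v f v; set b := \int[P]_v g v.
have sa : sqint P (fun=> - a) by exact: (sqint_cst P (- a)).
have sb : sqint P (fun=> - b) by exact: (sqint_cst P (- b)).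
have sfa : sqint P (fun w => f w - a) by exact: sqintD.
have sgb : sqint P (fun w => g w - b) by exact: sqintD.
have <- : cov P (fun w => f w - a) (fun w => g w - b) = cov P f g.
  rewrite (covDl sf sa sgb) (cov_cstl (- a) sgb) addr0.
  by rewrite covC (covDl sg sb sf) (cov_cstl (- b) sf) addr0 covC.
rewrite /cov meanD; [|exact: sqint_rint|exact: sqint_rint].
by rewrite mean_cst subrr mul0r subr0.
Qed.

Lemma markov_ge f (a : R) : measurable_fun setT f -> rint P f ->
  (forall w, 0 <= f w) -> 0 < a ->
  (P [set w | (a <= f w)%R] <= (a^-1 * \int[P]_w f w)%:E)%E.
Proof.
move=> mf fi f0 a0; have mA := measurable_ge a mf.
rewrite -(fineK (fin_num_measure P _ mA)) lee_fin -mean_indic//.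
rewrite -meanZ//; apply: mean_le => [||w].
- exact: integrable_indic.
- exact: rintZ.
- rewrite indicE; have [h|h] := leP a (f w).
    by rewrite mem_set// ler_pdivlMl// mulr1.
  rewrite memNset; last by apply/negP; rewrite -ltNge.
  by rewrite mulr_ge0// invr_ge0 ltW.
Qed.

Variable X : nat -> nat -> {RV P >-> C01 R}.
Variable mu : nat -> nat -> C01 R.
Hypothesis muE :
  forall n j, (1 <= j <= n)%N -> is_expectation P (X n j) (mu n j).

Local Notation Z n j t := (fun w => centered X mu n j w t).

Lemma centered_mixing : condA1 P X -> condA4 P X ->
  exists V r : R, [/\ 0 <= V, 0 <= r < 1 &
    forall n t, (forall j, (1 <= j <= n)%N -> sqint P (Z n j t)) /\
      forall i j, (1 <= i)%N -> (i <= j <= n)%N ->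
        `|\int[P]_w (centered X mu n i w t * centered X mu n j w t)|
          <= V * r ^+ (j - i)].
Proof.
move=> [K [nu [nu0 XK]]] [a [a01 mix]].
have [C [r [C0 r01 covC']]] := mixing_cov P K a01 nu0.
(* [C] covers positive lags; the second term covers lag 0, where mixing says nothing and [cov_le]
   with weight 1 bounds the variance. *)
pose V := C + 2 * Num.max (1 + K) 0.
have m0 : 0 <= Num.max (1 + K) 0 by rewrite le_max lexx orbT.
have mK : 1 + K <= Num.max (1 + K) 0 by rewrite le_max lexx.
exists V, r; split => //; first by rewrite /V; lra.
move=> n t.
have mom j : (1 <= j <= n)%N -> [/\ sqint P (fun w => X n j w t),
    \int[P]_w (X n j w t ^+ 2) <= 1 + K,
    rint P (fun w => `|X n j w t| `^ (2 + nu)) &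
    \int[P]_w (`|X n j w t| `^ (2 + nu)) <= K].
  move=> jn; have [i1 i2] := eval_moment t (ltW nu0) (XK n j jn).
  by have [] := mean_sqr_moment nu0 (measurable_eval X n j t) i1 i2; split.
have ZE j : (1 <= j <= n)%N -> Z n j t =
    (fun w => X n j w t - \int[P]_v (X n j v t)).
  by move=> jn; apply/funext => w; rewrite (eval_mean t (muE jn)).
split.
  move=> j jn; rewrite ZE//; have [sj _ _ _] := mom j jn.
  exact: sqintD sj (sqint_cst P (- _)).
move=> i j i1 /andP[ij jn].
have in' : (1 <= i <= n)%N by rewrite i1 (leq_trans ij).
have jn' : (1 <= j <= n)%N by rewrite jn (leq_trans i1).
have [si Xi2 mi1 mi2] := mom i in'; have [sj Xj2 mj1 mj2] := mom j jn'.
have -> : \int[P]_w (centered X mu n i w t * centered X mu n j w t) =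
    cov P (fun w => X n i w t) (fun w => X n j w t).
  rewrite -mean_centered_mul//; apply: eq_Rintegral => w _.
  by rewrite (eval_mean t (muE in')) (eval_mean t (muE jn')).
have r0 : 0 <= r ^+ (j - i) by rewrite exprn_ge0//; case/andP: r01.
move: ij; rewrite leq_eqVlt => /predU1P[eij|ij].
  subst j; rewrite subnn expr0 mulr1 /V.
  by have := cov_le ltr01 si sj; rewrite invr1 !mul1r; lra.
apply: (@le_trans _ _ (C * r ^+ (j - i))); last first.
  by rewrite ler_wpM2r// /V lerDl mulr_ge0.
apply: covC' => //; [exact: measurable_eval|exact: measurable_eval|].
move=> s s'; apply: tail_dependence_le => //; first by case/andP: a01.
by rewrite ij.
Qed.

(* The centered variables read away from [K], padded with [0] so that the
   estimates for infinite sequences apply. *)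
Definition rightC n K t i w : R :=
  if (K.+1 + i <= n)%N then centered X mu n (K.+1 + i) w t else 0.

Definition leftC n K t i w : R :=
  if (i < K)%N then centered X mu n (K - i) w t else 0.

(** Reading a row backwards from [K] preserves lags, and the padding zeros have vanishing mixed
    moments, so both sides obey the same decay. [V] is chosen before [n], [K] and [t], which makes
    the bound uniform in the position of the change. *)
Lemma two_sided_energy : condA1 P X -> condA4 P X ->
  exists2 V : R, 0 <= V & forall n K t q0 N, (K <= n)%N -> (0 < q0)%N ->
    let Y w := block_energy (rightC n K t ^~ w) q0 N +
               block_energy (leftC n K t ^~ w) q0 N in
    rint P Y /\ \int[P]_w Y w <= V / q0%:R.
Proof.
move=> A1 A4; have [V [r [V0 r01 ZV]]] := centered_mixing A1 A4.
have /andP[r0 r1] := r01.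
exists (2 * ((2 / (1 - r) + 9) * V * 2)).
  by rewrite !mulr_ge0// addr_ge0// divr_ge0//; lra.
move=> n K t q0 N Kn q00 Y; have [sZ cZ] := ZV n t.
have e0 (f : T -> R) : (forall w, f w = 0) -> \int[P]_w f w = 0.
  by move=> f0; rewrite -[RHS](mean_cst P 0); apply: eq_Rintegral => w _.
have s0 : sqint P (fun=> 0) by exact: (sqint_cst P 0).
have Vr k : 0 <= V * r ^+ k by rewrite mulr_ge0 ?exprn_ge0.
have [ri rE] : rint P (fun w => block_energy (rightC n K t ^~ w) q0 N) /\
    \int[P]_w (block_energy (rightC n K t ^~ w) q0 N) <=
    (2 / (1 - r) + 9) * V * 2 / q0%:R.
  apply: mean_block_energy => // [i|i j ij].
    by rewrite /rightC; have [h|h] := leqP (K.+1 + i) n => //; apply: sZ; lia.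
  rewrite /rightC; have [hj|hj] := leqP (K.+1 + j) n; last first.
    by rewrite e0// => w; rewrite mulr0.
  have hi : (K.+1 + i <= n)%N by lia.
  rewrite hi; apply: (le_trans (ler_norm _)).
  have -> : (j - i = (K.+1 + j) - (K.+1 + i))%N by lia.
  by apply: cZ; lia.
have [li lE] : rint P (fun w => block_energy (leftC n K t ^~ w) q0 N) /\
    \int[P]_w (block_energy (leftC n K t ^~ w) q0 N) <=
    (2 / (1 - r) + 9) * V * 2 / q0%:R.
  apply: mean_block_energy => // [i|i j ij].
    by rewrite /leftC; have [h|h] := ltnP i K => //; apply: sZ; lia.
  rewrite /leftC; have [hj|hj] := ltnP j K; last first.
    by rewrite e0// => w; rewrite mulr0.
  have hi : (i < K)%N by lia.
  rewrite hi; apply: (le_trans (ler_norm _)).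
  have -> : (j - i = (K - i) - (K - j))%N by lia.
  (* Reversal exchanges the earlier and the later variable. *)
  under eq_Rintegral do rewrite mulrC.
  by apply: cZ; lia.
split; first exact: rintD.
rewrite /Y meanD//; lra.
Qed.

(** The means inherit the constant [B] by integrating the increments, whence [2 * B] after
    centering. The exceptional sets of the countably many [j] are merged into one null set. *)
Lemma centered_lipschitz (rho : unit_itv R -> unit_itv R -> R)
    (M : {RV P >-> R}) (B : R) n : 0 < B ->
  (forall t t', 0 <= rho t t') ->
  condA1 P X -> condA3 P X rho M -> {ae P, forall w, `|M w| <= B} ->
  {ae P, forall w, forall j, (1 <= j <= n)%N -> forall t t',
    `|centered X mu n j w t - centered X mu n j w t'| <= 2 * B * rho t t'}.
Proof.
move=> B0 rho0 [K [nu [nu0 XK]]] [_ A3] MB.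
have XB j : (1 <= j <= n)%N -> {ae P, forall w, forall t t',
    `|X n j w t - X n j w t'| <= B * rho t t'}.
  move=> jn; apply: filterS2 (A3 n j jn) MB => w Xw Mw t t'.
  apply: le_trans (Xw t t') _; rewrite ler_wpM2r//.
  by apply: le_trans Mw; exact: ler_norm.
have muB j : (1 <= j <= n)%N -> forall t t',
    `|mu n j t - mu n j t'| <= B * rho t t'.
  move=> jn t t'.
  have sq u : rint P (fun w => X n j w u).
    have [i1 i2] := eval_moment u (ltW nu0) (XK n j jn).
    apply: sqint_rint.
    by have [] := mean_sqr_moment nu0 (measurable_eval X n j u) i1 i2.
  rewrite -!(eval_mean _ (muE jn)).
  rewrite -(RintegralB measurableT (sq t) (sq t')).
  have id : rint P (fun w => X n j w t - X n j w t').
    exact: (integrableB measurableT (sq t) (sq t')).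
  apply: (le_trans (le_normr_Rintegral measurableT id)).
  have ia : rint P (fun w => `|X n j w t - X n j w t'|).
    exact: integrable_norm id.
  have := @expectation_le _ _ _ P (fun w => `|X n j w t - X n j w t'|)
    (cst (B * rho t t')) (rint_meas ia) (measurable_cst _).
  rewrite expectation_cst unlock => h.
  rewrite -lee_fin fineK; last exact: integrable_fin_num.
  apply: h => // [w|]; first by rewrite mulr_ge0// ltW.
  by apply: filterS (XB j jn) => w; apply.
have XB' : {ae P, forall w, forall j, (1 <= j <= n)%N -> forall t t',
    `|X n j w t - X n j w t'| <= B * rho t t'}.
  apply: ae_foralln => j.
  have [jn|jn] := boolP (1 <= j <= n)%N; last by apply: aeW.
  by apply: filterS (XB j jn) => w h _; exact: h.
apply: filterS XB' => w Xw j jn t t'.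
have -> : centered X mu n j w t - centered X mu n j w t' =
    (X n j w t - X n j w t') - (mu n j t - mu n j t').
  by rewrite /centered !C01_DE !C01_NE; ring.
have := ler_normB (X n j w t - X n j w t') (mu n j t - mu n j t').
have := Xw j jn t t'; have := muB j jn t t'; lra.
Qed.

(** Moving to the nearest net point costs at most [e] per summand, so the error grows like the
    threshold [e m] itself: one fixed net serves all [m]. *)
Lemma sum_le_net (rho : unit_itv R -> unit_itv R -> R) (z : nat -> C01 R)
    (F : seq (unit_itv R)) (b e : R) m : 0 <= b ->
  (forall t, exists2 c, c \in F & b * rho c t <= e) ->
  (forall i, (i < m)%N -> forall t t', `|z i t - z i t'| <= b * rho t t') ->
  (forall c, c \in F -> `|\sum_(i < m) z i c| <= e * m%:R) ->
  `|\sum_(i < m) z i| <= 2 * e * m%:R.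
Proof.
move=> b0 net zl zF; apply: supnorm_le => t; rewrite sumCE.
have [c cF ct] := net t.
rewrite -(subrK (\sum_(i < m) z i c) (\sum_(i < m) z i t)).
apply: (le_trans (ler_normD _ _)).
have : `|\sum_(i < m) z i t - \sum_(i < m) z i c| <= e * m%:R.
  rewrite distrC -sumrB; apply: (le_trans (ler_norm_sum _ _ _)).
  apply: (@le_trans _ _ (\sum_(i < m) e)); last first.
    by rewrite sumr_const card_ord mulr_natr.
  by apply: ler_sum => i _; apply: le_trans ct; exact: zl.
have := zF c cF; lra.
Qed.

End noise.

Theorem theorem4p2 (R : realType) (d : measure_display)
    (Omega : measurableType d) (P : probability Omega R)
    (rho : unit_itv R -> unit_itv R -> R)
    (s_star : R) (mu1 mu2 : C01 R)
    (X : nat -> nat -> {RV P >-> C01 R}) (M : {RV P >-> R}) :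
  is_metric rho -> totally_bounded rho ->
  0 < s_star < 1 ->
  0 < `|mu1 - mu2| ->
  (forall n j, (1 <= j <= n)%N ->
     is_expectation P (X n j) (cp_mean s_star mu1 mu2 n j)) ->
  condA1 P X ->
  condA2 P X (cp_mean s_star mu1 mu2) ->
  condA3 P X rho M ->
  (exists B : R, {ae P, forall w, `|M w| <= B}) ->
  condA4 P X ->
  condA5 P X (cp_mean s_star mu1 mu2) ->
  bigO_P P (fun n w => `|s_tilde X n w - s_star|) (fun n => n%:R^-1).
Proof.
move=> [rho0 _ _ _] tb /andP[s0 s1] d0 muE A1 _ A3 [B MB] A4 _ eps eps0.
pose B' := `|B| + 1.
have B'0 : 0 < B' by rewrite /B' ltr_wpDl.
have {}MB : {ae P, forall w, `|M w| <= B'}.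
  apply: filterS MB => w /le_trans; apply.
  by rewrite /B' (le_trans (ler_norm B))// lerDl.
pose c := Num.min s_star (1 - s_star) / 2.
have m0 : 0 < Num.min s_star (1 - s_star) by rewrite lt_min s0 subr_gt0.
have ms : Num.min s_star (1 - s_star) <= s_star by rewrite ge_min lexx.
have ms' : Num.min s_star (1 - s_star) <= 1 - s_star.
  by rewrite ge_min lexx orbT.
have c0 : 0 < c by rewrite divr_gt0.
have cs : 2 * c <= s_star by rewrite /c; lra.
have cs' : 2 * c <= 1 - s_star by rewrite /c; lra.
pose e := c ^+ 2 * `|mu1 - mu2| / 24.
have e0 : 0 < e by rewrite divr_gt0// mulr_gt0// exprn_gt0.
have e20 : 0 < e / 2 by rewrite divr_gt0.
have b0 : 0 < 2 * B' by rewrite mulr_gt0.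
(* The radius is [e / 2] over the Lipschitz constant [2 * B']; half of [e] is kept for the sums at
   the net points. *)
have [_ [/finite_seqP[F ->] net0]] := tb _ (divr_gt0 e20 b0).
have net t : exists2 u, u \in F & 2 * B' * rho u t <= e / 2.
  have [u uF ut] := net0 t; exists u => //.
  by rewrite mulrC -ler_pdivlMr// ltW.
have [V V0 energy] := two_sided_energy muE A1 A4.
(* The threshold of [block_energy_small] at level [e / 2], which [sum_le_net] doubles to [e]. *)
pose a := (e / 2) ^+ 2 / 2.
have a0 : 0 < a by rewrite divr_gt0// exprn_gt0.
(* Makes the Markov bound [size F * V / (q0 * a)] smaller than [eps]. *)
have [q0 q00 q0big] : exists2 q0, (0 < q0)%N &
    (size F)%:R * V / (a * eps) < q0%:R.
  by exists (Num.truncn ((size F)%:R * V / (a * eps))).+1; last exact: truncnS_gt.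
have [C0 C0E] : exists C0, C0 = (q0 ^ 2)%N by exists (q0 ^ 2)%N.
have C0_gt0 : (1 <= C0)%N by rewrite C0E expn_gt0 q00.
(* The bound on [n] is the size condition of [change_point_index]. *)
exists C0.+1%:R, (Num.truncn ((C0%:R + 2) / c)).+1 => // n /= nbig.
have ncC : C0%:R + 2 <= n%:R * c.
  rewrite -ler_pdivrMr//; apply: ltW; apply: lt_le_trans (truncnS_gt _) _.
  by rewrite ler_nat.
have [K KE] : exists K, K = Num.truncn (n%:R * s_star) by eexists.
have := change_point_index c0 cs cs' ncC; rewrite -KE => -[cK cK' C0K nK].
(* Summing over the net and both sides lets a single Markov inequality control all the sequences.
   The cutoff [n.+1] suffices because every [m <= n] is below [n.+1 ^ 2]. *)
pose Y w := \sum_(t <- F)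
  (block_energy (rightC X (cp_mean s_star mu1 mu2) n K t ^~ w) q0 n.+1 +
   block_energy (leftC X (cp_mean s_star mu1 mu2) n K t ^~ w) q0 n.+1).
have Kn : (K <= n)%N by exact: leq_trans (leq_addr _ _) nK.
have iY : rint P Y.
  by apply: rint_sum => t; exact: (energy n K t q0 n.+1 Kn q00).1.
have EY : \int[P]_w Y w <= (size F)%:R * V / q0%:R.
  rewrite mean_sum; last by move=> t; exact: (energy n K t q0 n.+1 Kn q00).1.
  apply: (@le_trans _ _ (\sum_(t <- F) V / q0%:R)).
    by apply: ler_sum => t _; exact: (energy n K t q0 n.+1 Kn q00).2.
  by rewrite big_const_seq count_predT iter_addr_0 -[leLHS]mulr_natl mulrA.
have Y0 w : 0 <= Y w.
  by apply: sumr_ge0 => t _; rewrite addr_ge0 ?block_energy_ge0.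
have PY : (P [set w | (a <= Y w)%R] < eps%:E)%E.
  apply: le_lt_trans (markov_ge (rint_meas iY) iY Y0 a0) _.
  rewrite lte_fin ltr_pdivrMl//; apply: le_lt_trans EY _.
  rewrite ltr_pdivrMr ?ltr0n// -ltr_pdivrMl ?mulr_gt0// mulrC.
  exact: q0big.
have [N [mN PN lip]] := centered_lipschitz muE n B'0 rho0 A1 A3 MB.
have mYa := measurable_ge a (rint_meas iY).
(* The null set [N] enters the bound as a summand 0, so the error event need only lie in its union
   with the event [a <= Y]. *)
apply: le_lt_trans PY; rewrite -[leRHS]add0e -PN.
apply: (@le_trans _ _ (P (N `|` [set w | a <= Y w]))); last exact: measureU2.
apply: le_measure; rewrite ?inE; [|exact: measurableU|].
  exact: (measurable_s_tilde X n
    [set x | C0.+1%:R * `|n%:R^-1| < `| `|x - s_star| | ]).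
move=> w /= far; have [Nw|Nw] := pselect (N w); first by left.
right; rewrite leNgt; apply/negP => small; move: far; apply/negP; rewrite -leNgt.
have lipw : forall j, (1 <= j <= n)%N -> forall t t',
    `|centered X (cp_mean s_star mu1 mu2) n j w t -
      centered X (cp_mean s_star mu1 mu2) n j w t'| <= 2 * B' * rho t t'.
  by apply: contrapT => h; apply: Nw; exact: lip.
have smallt t : t \in F ->
    block_energy (rightC X (cp_mean s_star mu1 mu2) n K t ^~ w) q0 n.+1 < a /\
    block_energy (leftC X (cp_mean s_star mu1 mu2) n K t ^~ w) q0 n.+1 < a.
  move=> tF; have r0 := block_energy_ge0
    (rightC X (cp_mean s_star mu1 mu2) n K t ^~ w) q0 n.+1.
  have l0 := block_energy_ge0
    (leftC X (cp_mean s_star mu1 mu2) n K t ^~ w) q0 n.+1.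
  have : block_energy (rightC X (cp_mean s_star mu1 mu2) n K t ^~ w) q0 n.+1 +
    block_energy (leftC X (cp_mean s_star mu1 mu2) n K t ^~ w) q0 n.+1 <= Y w.
    rewrite /Y (big_rem t)//= lerDl; apply: sumr_ge0 => u _.
    by rewrite addr_ge0 ?block_energy_ge0.
  move=> /le_lt_trans /(_ small) lt; split; apply: le_lt_trans lt.
    by rewrite lerDl.
  by rewrite lerDr.
have mn2 m : (m <= n)%N -> (m < n.+1 ^ 2)%N.
  by move=> mn; rewrite (leq_trans (_ : m < n.+1)%N)// -mulnn leq_pmulr.
have ee : 2 * (e / 2) = e by field.
rewrite normr_id (ger0_norm (_ : 0 <= n%:R^-1)) ?invr_ge0//.
apply: (@s_tilde_close _ _ _ X s_star c mu1 mu2 n K C0 w) => //.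
- exact: ltW.
- by clear - C0K nK; lia.
- by clear - C0K nK; lia.
- exact: ltnW.
- by clear - nK; lia.
- move=> m /andP[C0m mK]; rewrite -/e -ee.
  apply: (@sum_le_net _ rho
    (fun i => centered X (cp_mean s_star mu1 mu2) n (K - i) w)
    F _ _ m (ltW b0) net) => [i im|t tF].
    by apply: lipw; clear - im mK Kn; lia.
  rewrite (eq_bigr (fun i : 'I_m =>
      leftC X (cp_mean s_star mu1 mu2) n K t i w)); last first.
    by move=> i _; rewrite /leftC (leq_trans (ltn_ord i) mK).
  apply: (block_energy_small q00 e20 (smallt t tF).2).
  by rewrite -C0E C0m mn2// (leq_trans mK).
- move=> m /andP[C0m mK]; rewrite -/e -ee.
  apply: (@sum_le_net _ rho
    (fun i => centered X (cp_mean s_star mu1 mu2) n (K.+1 + i) w)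
    F _ _ m (ltW b0) net) => [i im|t tF].
    by apply: lipw; clear - im mK Kn; lia.
  rewrite (eq_bigr (fun i : 'I_m =>
      rightC X (cp_mean s_star mu1 mu2) n K t i w)); last first.
    move=> i _; rewrite /rightC ifT//.
    by have := ltn_ord i; clear - mK Kn; lia.
  apply: (block_energy_small q00 e20 (smallt t tF).1).
  by rewrite -C0E C0m mn2// (leq_trans mK)// leq_subr.
Qed.
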